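(* There exists a constant $\lambda>0$ depending only on $m$ and $\beta$ such that for every probability measure $\mu$ over $\mathbb{R}^d$, every closed domain $F\subset\mathbb{R}^d$, all $x,y\in\mathbb{R}^d$ and every geodesic $\gamma\in\Gamma^\star_{\mu,F}(x,y)$, $$|\gamma|\le\lambda\,\|d_\mu\|_{\infty,\gamma}.$$
   Context: $\mathbb{R}^d$ carries the Euclidean norm $\|\cdot\|$; $B(x,r)$ is the open ball. Fixed real parameters: $m\in(0,1]$, $p\ge 1$, $\beta\ge 1$. For a probability measure $\mu$ on $\mathbb{R}^d$, $\delta_{\mu,u}(x)=\inf\{r>0:\mu(B(x,r))>u\}$ and the distance-to-measure is $d_\mu(x)=\left(\frac1m\int_0^m\delta_{\mu,u}(x)^p\,du\right)^{1/p}$. It is finite everywhere when $m<1$ or when $\mu$ has compact support; when $m=1$, $\mu$ is assumed to be such that $d_\mu$ is finite. A rectifiable path is a continuous $\gamma:[0,1]\to\mathbb{R}^d$ of finite Euclidean length $|\gamma|=\int_0^1\|\dot\gamma(t)\|\,dt$, parametrized so as to be Lipschitz (always possible, e.g. with constant speed). Its FDTM length is $D_\mu(\gamma)=\int_0^1 d_\mu(\gamma(t))^\beta\|\dot\gamma(t)\|\,dt$. For a closed set $F\subset\mathbb{R}^d$ (the domain) and $x,y\in\mathbb{R}^d$, $\Gamma_F(x,y)$ is the set of rectifiable paths $\gamma$ with $\gamma(0)=x$, $\gamma(1)=y$ such that for every open interval $I\subset[0,1]$ with $\gamma(I)\subset\mathbb{R}^d\setminus F$ there is a unit vector $u\in\mathbb{R}^d$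 with $\dot\gamma(t)=\|\dot\gamma(t)\|u$ for all $t\in I$ where $\dot\gamma$ is defined. The Fermat distance-to-measure is $D_{\mu,F}(x,y)=\inf_{\gamma\in\Gamma_F(x,y)}D_\mu(\gamma)$, and $\Gamma^\star_{\mu,F}(x,y)$ is the set of geodesics, i.e. of $\gamma\in\Gamma_F(x,y)$ with $D_\mu(\gamma)=D_{\mu,F}(x,y)$. Finally $\|d_\mu\|_{\infty,\gamma}=\max_{t\in[0,1]}d_\mu(\gamma(t))$. *)

(* Defs.v *)
From mathcomp Require Export all_boot all_order all_algebra.
From mathcomp Require Export all_classical all_reals all_analysis.

Set Implicit Arguments.
Unset Strict Implicit.
Unset Printing Implicit Defensive.

Export Order.TTheory GRing.Theory Num.Theory.
Export numFieldNormedType.Exports.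

Local Open Scope classical_set_scope.
Local Open Scope ring_scope.
Local Open Scope ereal_scope.

(* The library norm on ['rV[R]_d] is the sup norm, hence the Euclidean norm
   below.  The two are equivalent, so [open], [closed], [derivable] and the
   derivative [derive1 g] are the usual Euclidean ones. *)
Definition enorm (R : realType) (d : nat) (v : 'rV[R]_d) : R :=
  Num.sqrt (\sum_(i < d) v ord0 i ^+ 2)%R.

Definition eball (R : realType) (d : nat) (x : 'rV[R]_d) (r : R) :
    set 'rV[R]_d :=
  [set y | (enorm (y - x) < r)%R].

(* R^d with its Borel sigma-algebra *)
Definition borelRd (R : realType) (d : nat) :=
  g_sigma_algebraType (@open 'rV[R]_d).

Section FermatDTM.
Context (R : realType) (d : nat).
Implicit Types (mu : probability (borelRd R d) R) (m p beta u : R).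
Implicit Types (x y : 'rV[R]_d) (F : set 'rV[R]_d) (g : R -> 'rV[R]_d).

(* Equal to +oo when no ball has mass > u, e.g. for u = 1. *)
Definition delta mu u x : \bar R :=
  ereal_inf [set r%:E | r in [set r : R | (0 < r)%R /\ u%:E < mu (eball x r)]].

Definition dtm m p mu x : \bar R :=
  ((m^-1)%:E * \int[lebesgue_measure]_(u in `[0%R, m]) (delta mu u x `^ p))
    `^ p^-1.

(* A path is a map on the whole real line, of which only the restriction to
   [0, 1] is ever used.  Lipschitz continuity entails continuity, finite length
   and almost everywhere differentiability on [0, 1]. *)
Definition rectifiable_path g : Prop :=
  exists K : R, forall s t : R, s \in `[0%R, 1%R] -> t \in `[0%R, 1%R] ->
    (enorm (g s - g t) <= K * `|s - t|)%R.

(* The points of [0, 1] where [derive1 g] is a default value (and the endpoints,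
   where it may depend on the extension of g outside [0, 1]) are negligible. *)
Definition path_length g : \bar R :=
  \int[lebesgue_measure]_(t in `[0%R, 1%R]) (enorm (derive1 g t))%:E.

Definition fdtm_length m p beta mu g : \bar R :=
  \int[lebesgue_measure]_(t in `[0%R, 1%R])
    (dtm m p mu (g t) `^ beta * (enorm (derive1 g t))%:E).

(* Gamma_F(x, y): between visits to F the path moves in a constant direction. *)
Definition admissible F x y g : Prop :=
  [/\ rectifiable_path g, g 0%R = x, g 1%R = y &
    forall a b : R, (0 <= a)%R -> (a < b)%R -> (b <= 1)%R ->
      (forall t, t \in `]a, b[ -> ~ F (g t)) ->
      exists2 v : 'rV[R]_d, enorm v = 1%R &
        forall t, t \in `]a, b[ -> derivable g t 1%R ->
          derive1 g t = (enorm (derive1 g t) *: v)%R].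

Definition fermat_dtm m p beta mu F x y : \bar R :=
  ereal_inf [set fdtm_length m p beta mu g | g in admissible F x y].

Definition geodesic m p beta mu F x y g : Prop :=
  admissible F x y g /\
  fdtm_length m p beta mu g = fermat_dtm m p beta mu F x y.

(* A maximum as soon as d_mu is finite, since d_mu is then continuous. *)
Definition dtm_max m p mu g : \bar R :=
  ereal_sup [set dtm m p mu (g t) | t in `[0%R, 1%R]].

End FermatDTM.

(* Main.v *)
From HB Require Import structures.
Require Import Defs.
From mathcomp Require Import ring lra measurable_realfun.

(** Let f(t) be the distance-to-measure at the point g(t) of the geodesic and M
    its maximum.  Call stops the end times and the times spent in F, and gaps
    the intervals between consecutive stops; the energy of a piece of path is its
    FDTM length.  Three facts carry the proof.

    - Low levels are small.  A point with d_mu <= r has a ball of radius 3r of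
      mass more than m/4 ([dtm_mass]), so at most 4/m such points are
      6r-separated and {d_mu <= r} lies in at most 4/m balls of radius 6r
      ([dtm_cover]).
    - Shortcuts between stops are allowed.  Replacing the path between two stops
      s < t by a segment keeps it admissible ([shortcut_admissible]), so the
      energy spent by the geodesic on [s, t] is at most |g t - g s| C^beta when
      d_mu <= C on that segment ([geodesic_shortcut]).  A shortcut that starts
      inside a gap would create a forbidden corner.
    - Gaps are straight, so inside a gap length is distance
      ([straight_increment]).  With the covering, the part of a gap where f <= r
      has length at most 48 r / m, however long the gap is ([gap_low]).

    The domain F may leave gaps much longer than the level f, so the path is
    sliced not by f alone but by the scale of t, the larger of f(t) and of the
    length of the gap around t.  Consider the scales in (r/2, r]
    ([scale_bound]).  Their points lie in 4/m balls of radius 6r, and the visits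
    to one ball take place between two stops at distance at most 14r, where d_mu
    is at most 8r on the segment; hence the energy spent meanwhile is at most
    14r (8r)^beta.  Where f > c := mr/192 the energy is at least c^beta per unit
    of length.  Where f <= c the time is in a gap longer than r/2, at most half
    of which is at level f <= c, so this part is no longer than the previous one
    ([long_low_le_high]).  Thus the scales in (r/2, r] contribute a length O(r).
    The contributions of r, r/2, r/4, and so on sum to O(r)
    ([small_scale_bound]); what remains has f = 0, which happens at finitely
    many points ([nu_zeros]).  Finally all scales are at most 48 M / m by the
    third fact ([length_le_max]).

    The combinatorial part is carried out for an abstract length measure nu on
    the time axis.  Turning the speed of a Lipschitz path into such a measure
    requires that the path is almost everywhere derivable and is the primitive
    of its derivative ([lipschitz_density]), which comes from the
    Radon-Nikodym theorem and Lebesgue differentiation. *)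

Set Implicit Arguments.
Unset Strict Implicit.
Unset Printing Implicit Defensive.

Local Open Scope classical_set_scope.
Local Open Scope ring_scope.
Local Open Scope ereal_scope.

(** * The Euclidean norm *)

Section enorm.
Context (R : realType) (d : nat).
Implicit Types v w x y z : 'rV[R]_d.
Local Open Scope ring_scope.

Lemma enorm_ge0 v : 0 <= enorm v.
Proof. exact: sqrtr_ge0. Qed.

Lemma sqr_enorm v : enorm v ^+ 2 = \sum_(i < d) v ord0 i ^+ 2.
Proof. by rewrite sqr_sqrtr// sumr_ge0// => i _; exact: sqr_ge0. Qed.

Lemma enorm0 : enorm (0 : 'rV[R]_d) = 0.
Proof. by rewrite /enorm big1 ?sqrtr0// => i _; rewrite mxE expr0n. Qed.

Lemma enormZ (a : R) v : enorm (a *: v) = `|a| * enorm v.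
Proof.
rewrite /enorm -(sqrtr_sqr a) -sqrtrM ?sqr_ge0// mulr_sumr.
by congr Num.sqrt; apply: eq_bigr => i _; rewrite mxE exprMn.
Qed.

Lemma enormN v : enorm (- v) = enorm v.
Proof. by rewrite -scaleN1r enormZ normrN1 mul1r. Qed.

Lemma enormB v w : enorm (v - w) = enorm (w - v).
Proof. by rewrite -enormN opprB. Qed.

Lemma coord_le_enorm v i : `|v ord0 i| <= enorm v.
Proof.
rewrite -sqrtr_sqr /enorm ler_wsqrtr// (bigD1 i)//= lerDl sumr_ge0// => j _.
exact: sqr_ge0.
Qed.

Lemma enorm_eq0 v : enorm v = 0 -> v = 0.
Proof.
move=> v0; apply/rowP => i; rewrite mxE; apply/eqP; rewrite -normr_le0 -v0.
exact: coord_le_enorm.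
Qed.

Lemma dot_le_enorm v w : \sum_(i < d) v ord0 i * w ord0 i <= enorm v * enorm w.
Proof.
have [v0|v0] := eqVneq (enorm v) 0.
  by rewrite v0 mul0r big1// => i _; rewrite (enorm_eq0 v0) mxE mul0r.
have [w0|w0] := eqVneq (enorm w) 0.
  by rewrite w0 mulr0 big1// => i _; rewrite (enorm_eq0 w0) mxE mulr0.
have vw0 : 0 < enorm v * enorm w.
  by rewrite mulr_gt0 // lt_neqAle eq_sym enorm_ge0 andbT.
have vw2 : 0 < 2 * (enorm v * enorm w) by rewrite mulr_gt0.
rewrite -(ler_pM2l vw2).
rewrite [leRHS](_ : _ = enorm w ^+ 2 * enorm v ^+ 2 + enorm v ^+ 2 * enorm w ^+ 2);
  last by ring.
rewrite {1}(sqr_enorm v) {2}(sqr_enorm w) !mulr_sumr -big_split/=.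
apply: ler_sum => i _.
rewrite -subr_ge0 [leRHS](_ : _ =
  (enorm w * v ord0 i - enorm v * w ord0 i) ^+ 2) ?sqr_ge0//; ring.
Qed.

Lemma ler_enormD v w : enorm (v + w) <= enorm v + enorm w.
Proof.
rewrite -(@ler_pXn2r _ 2)// ?nnegrE ?addr_ge0 ?enorm_ge0//.
rewrite sqrrD !sqr_enorm.
under eq_bigr do rewrite mxE sqrrD.
rewrite !big_split/= lerD2r lerD2l mulr2n.
by rewrite lerD// dot_le_enorm.
Qed.

Lemma ler_enorm_distD z v w : enorm (v - w) <= enorm (v - z) + enorm (z - w).
Proof. by rewrite -[v - w](subrKA z) ler_enormD. Qed.

Lemma ler_dist_enorm v w : `|enorm v - enorm w| <= enorm (v - w).
Proof.
have h (a b : 'rV[R]_d) : enorm a - enorm b <= enorm (a - b).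
  by rewrite lerBlDr -{1}(subrK b a) ler_enormD.
by rewrite ler_norml h andbT lerNl opprB enormB h.
Qed.

Lemma enorm_le_sum v : enorm v <= \sum_(i < d) `|v ord0 i|.
Proof.
rewrite -(@ler_pXn2r _ 2)// ?nnegrE ?enorm_ge0 ?sumr_ge0//.
rewrite sqr_enorm expr2 mulr_suml; apply: ler_sum => i _.
rewrite -real_normK ?num_real// expr2 ler_wpM2l//.
by rewrite (bigD1 i)//= lerDl sumr_ge0.
Qed.

Lemma norm_le_enorm v : `|v| <= enorm v.
Proof.
rewrite /Num.Def.normr/= mx_normrE (bigmax_le _ (enorm_ge0 v))//= => -[i j] _ /=.
by rewrite ord1 coord_le_enorm.
Qed.

Lemma enorm_le_norm v : enorm v <= d%:R * `|v|.
Proof.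
rewrite (le_trans (enorm_le_sum v))//.
have -> : d%:R * `|v| = \sum_(i < d) `|v|.
  by rewrite sumr_const card_ord mulr_natl.
apply: ler_sum => i _; rewrite [leRHS]/Num.Def.normr/= mx_normrE.
exact: (le_bigmax _ (fun ij => `|v ij.1 ij.2|) (ord0, i)).
Qed.

Lemma continuous_enorm : continuous (@enorm R d).
Proof.
move=> v; apply/(@cvgrPdist_lt _ _ _ (nbhs v) (nbhs_filter v)) => e e0.
have ed : 0 < e / d.+1%:R by rewrite divr_gt0.
apply: (@filterS _ (nbhs v) (nbhs_filter v) (ball v (e / d.+1%:R))); last first.
  exact: nbhsx_ballx.
move=> w; rewrite -ball_normE/= => vw.
rewrite (le_lt_trans (ler_dist_enorm _ _))//.
rewrite (le_lt_trans (enorm_le_norm _))//.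
rewrite (@le_lt_trans _ _ (d.+1%:R * `|v - w|))//.
  by rewrite ler_wpM2r// ler_nat.
by rewrite mulrC -ltr_pdivlMr.
Qed.

End enorm.

(** * Lipschitz functions are primitives *)

(** The Stieltjes measures of G and of x - G x add up to the Lebesgue measure,
    since they do so on intervals; each is therefore below it. *)
Lemma increment_measure_le (R : realType) (G : R -> R) :
  (forall x y, (x <= y)%R -> (0 <= G y - G x <= y - x)%R) ->
  exists nu : {measure set (measurableTypeR R) -> \bar R},
    (forall a b, (a <= b)%R -> nu `]a, b]%classic = (G b - G a)%:E) /\
    (forall A, measurable A -> nu A <= lebesgue_measure A).
Proof.
move=> Gxy.
have contd (H : R -> R) : (forall x y, (x <= y)%R -> (0 <= H y - H x <= y - x)%R) ->
    right_continuous H.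
  move=> Hxy x; apply/cvgrPdist_lt => e e0.
  near=> y.
  have xy : (x <= y)%R by near: y; exact: nbhs_right_ge.
  have /andP[H0 H1] := Hxy _ _ xy.
  rewrite distrC ger0_norm// (le_lt_trans H1)//.
  rewrite ltrBlDr; near: y; apply: nbhs_right_lt.
  by rewrite ltrDr.
have ndG : nondecreasing G.
  by move=> x y /Gxy /andP[]; rewrite subr_ge0.
pose H x := (x - G x)%R.
have Hxy x y : (x <= y)%R -> (0 <= H y - H x <= y - x)%R.
  by move=> /Gxy /andP[h1 h2]; rewrite /H; lra.
have ndH : nondecreasing H.
  by move=> x y /Hxy /andP[]; rewrite subr_ge0.
pose mG := isCumulative.Build _ _ _ G ndG (contd _ Gxy).
pose cG : cumulative R R := HB.pack G mG.
pose mH := isCumulative.Build _ _ _ H ndH (contd _ Hxy).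
pose cH : cumulative R R := HB.pack H mH.
have lsE (f : cumulative R R) a b : (a <= b)%R ->
    lebesgue_stieltjes_measure f `]a, b]%classic = (f b - f a)%:E.
  move=> ab; rewrite /lebesgue_stieltjes_measure /measure_extension measurable_mu_extE/=.
    by rewrite wlength_itv_bnd.
  exact: is_ocitv.
exists (lebesgue_stieltjes_measure cG); split; first by move=> a b; exact: lsE.
move=> A mA.
suff -> : lebesgue_measure A =
    measure_add (lebesgue_stieltjes_measure cG) (lebesgue_stieltjes_measure cH) A.
  by rewrite [leRHS]measure_addE leeDl.
apply: lebesgue_stieltjes_measure_unique => //.
move=> X [[a b] _ <-]; rewrite [RHS]measure_addE.
have [ab|ba] := leP a b; last first.
  by rewrite set_itv_ge ?bnd_simp -?leNgt ?(ltW ba)// !measure0 adde0.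
transitivity ((G b - G a)%:E + (H b - H a)%:E).
  by rewrite [LHS]lsE//= /H -EFinD; congr EFin; ring.
by congr (_ + _); exact/esym/lsE.
Unshelve. all: by end_near. Qed.

(** The Stieltjes measure of G is absolutely continuous; its density f has
    primitive G by construction and is the derivative of G at its Lebesgue
    points. *)
Lemma increment_density (R : realType) (G : R -> R) :
  (forall x y, (x <= y)%R -> (0 <= G y - G x <= y - x)%R) ->
  exists f : R -> R, [/\ measurable_fun setT f,
    lebesgue_measure.-integrable setT (EFin \o f),
    forall s t, (0 <= s)%R -> (s <= t)%R -> (t <= 1)%R ->
      (G t - G s)%:E = \int[lebesgue_measure]_(x in `]s, t]) (f x)%:E &
    {ae lebesgue_measure, forall t : R, (0 < t < 1)%R -> is_derive t (1 : R)%R G (f t)}].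
Proof.
move=> Gxy.
have [nu [nuE nule]] := increment_measure_le Gxy.
have mI : measurable (`]0%R, 1%R]%classic : set (measurableTypeR R)) by exact: measurable_itv.
have nuI : nu (`]0%R, 1%R]%classic : set (measurableTypeR R)) < +oo.
  by rewrite nuE// ltry.
pose nuf : {finite_measure set (measurableTypeR R) -> \bar R} := mfrestr mI nuI.
have dom : charge_of_finite_measure nuf `<< @lebesgue_measure R.
  move=> A A0 B mB BA; rewrite /charge_of_finite_measure.
  have mBI : measurable (B `&` `]0%R, 1%R]%classic) by exact: measurableI.
  have B0 := A0 _ mBI (subset_trans (@subIsetl _ _ _) BA).
  apply/eqP; rewrite eq_le measure_ge0 andbT -B0; exact: nule.
pose f0 := Radon_Nikodym (charge_of_finite_measure nuf) (@lebesgue_measure R).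
have f0fin x : f0 x \is a fin_num by exact: Radon_Nikodym_fin_num.
have if0 : lebesgue_measure.-integrable setT f0 by exact: Radon_Nikodym_integrable.
pose f x := fine (f0 x).
have fE : EFin \o f = f0 by apply/funext => x /=; rewrite fineK.
have if_ : lebesgue_measure.-integrable setT (EFin \o f) by rewrite fE.
have mf : measurable_fun setT f.
  by apply/measurable_EFinP; exact: (measurable_int _ if_).
have GE s t : (0 <= s)%R -> (s <= t)%R -> (t <= 1)%R ->
      (G t - G s)%:E = \int[lebesgue_measure]_(x in `]s, t]) (f x)%:E.
  move=> s0 st t1; rewrite -nuE//.
  transitivity (charge_of_finite_measure nuf `]s, t]%classic).
    rewrite /charge_of_finite_measure/= /mfrestr /mrestr.
    congr (nu _); apply/esym/setIidl => x /=; rewrite !in_itv/= => /andP[sx xt].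
    by rewrite (le_lt_trans s0 sx) (le_trans xt t1).
  rewrite (Radon_Nikodym_integral dom)//.
  by apply: eq_integral => x _; rewrite fineK//; exact: f0fin.
exists f; split => //.
have := @FTC1 R f (BRight 0%R) _ _.
case/(_ _ _)/Wrap => [y||].
- exact: integrableS if_.
- apply: open_integrable_locally => //; exact: openT.
apply: filterS; first exact: (ae_filter_ringOfSetsType lebesgue_measure).
move=> t Ft /andP[t0 t1].
have [dF F't] := Ft t0.
pose F x := (\int[lebesgue_measure]_(t0 in `]0%R, x]) f t0)%R.
have FG : {near t, F =1 (fun x => G x - G 0)%R}.
  near=> x.
  have x0 : (0 <= x)%R by near: x; exact: lt_le_nbhsr.
  have x1 : (x <= 1)%R by near: x; exact: lt_le_nbhsl.
  by rewrite /F /Rintegral -GE.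
have -> : G = ((fun x => G x - G 0) + cst (G 0))%R.
  by apply/funext => x /=; rewrite !fctE subrK.
rewrite -[f t]addr0 -F't derive1E (near_eq_derive _ FG).
apply: is_deriveD; apply: DeriveDef => //.
exact: near_eq_derivable dF.
Unshelve. all: by end_near. Qed.

(** Adding K x to a K-Lipschitz function makes it nondecreasing, and dividing by
    2 K then brings its increments below those of the identity. *)
Lemma lipschitz_density_scalar (R : realType) (phi : R -> R) (K : R) :
  (forall s t, `|phi s - phi t| <= K * `|s - t|)%R ->
  exists f : R -> R, [/\ measurable_fun setT f,
    lebesgue_measure.-integrable `[0%R, 1%R] (EFin \o f),
    forall s t, (0 <= s)%R -> (s <= t)%R -> (t <= 1)%R ->
      (phi t - phi s)%:E = \int[lebesgue_measure]_(x in `]s, t]) (f x)%:E &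
    {ae lebesgue_measure, forall t : R, (0 < t < 1)%R -> is_derive t (1 : R)%R phi (f t)}].
Proof.
wlog K0 : K / (0 < K)%R => [hw phiK|].
  apply: (hw (`|K| + 1)%R) => [|s t]; first by rewrite ltr_wpDl.
  rewrite (le_trans (phiK s t))// ler_wpM2r//.
  by rewrite (le_trans (ler_norm K))// lerDl.
move=> phiK.
pose G x := ((2 * K)^-1 * (phi x + K * x))%R.
have K2 : (0 < 2 * K)%R by rewrite mulr_gt0.
have phiE : phi = ((2 * K) \*: G + (- K) \*: id)%R.
  apply/funext => x; rewrite !fctE.
  transitivity (2 * K * G x + - K * x)%R => //.
  by rewrite /G; field; exact: lt0r_neq0.
have Gxy x y : (x <= y)%R -> (0 <= G y - G x <= y - x)%R.
  move=> xy; have := phiK y x.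
  rewrite (@ger0_norm _ (y - x)) ?subr_ge0// ler_norml => /andP[h1 h2].
  rewrite /G -mulrBr; apply/andP; split; last by rewrite mulrC ler_pdivrMr//; nra.
  by rewrite ler_wpM2l ?invr_ge0 ?(ltW K2)//; nra.
have [f [mf if_ GE Gf]] := increment_density Gxy.
have icst (s t k : R) : lebesgue_measure.-integrable `[s, t] (cst k%:E).
  apply: (@continuous_compact_integrable _ (cst k)); first exact: segment_compact.
  by apply: continuous_subspaceT => x; exact: cvg_cst.
have iKf (A : set (measurableTypeR R)) : measurable A -> lebesgue_measure.-integrable A (EFin \o (fun x => 2 * K * f x)%R).
  move=> mA; have := integrableZl mA (2 * K)%R (integrableS measurableT mA (@subsetT _ A) if_).
  by apply: eq_integrable => //.
have m01 (s t : R) : measurable (`[s, t]%classic : set (measurableTypeR R)) by exact: measurable_itv.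
have mst (s t : R) : measurable (`]s, t]%classic : set (measurableTypeR R)) by exact: measurable_itv.
have iE : EFin \o (fun x => 2 * K * f x - K)%R = (EFin \o (fun x => 2 * K * f x)%R) \- cst K%:E.
  by apply/funext => x /=; rewrite EFinB.
exists (fun x => 2 * K * f x - K)%R; split.
- by apply: measurable_funB => //; exact: measurable_funM.
- by rewrite iE; apply: integrableB => //; exact: iKf.
- move=> s t s0 st t1.
  have ic := integrableS (m01 s t) (mst s t) (@subset_itv_oc_cc _ _ _ _) (icst s t K).
  have iZ : \int[lebesgue_measure]_(x in `]s, t]) (2 * K * f x)%:E =
      (2 * K)%:E * \int[lebesgue_measure]_(x in `]s, t]) (f x)%:E.
    under eq_integral do rewrite EFinM.
    by rewrite integralZl//; exact: integrableS if_.
  have := integralB (mst s t) (iKf _ (mst s t)) ic; rewrite -iE => ->.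
  rewrite [X in _ = X - _]iZ.
  rewrite -GE// integral_cst//= lebesgue_measure_itv/= lte_fin.
  have -> : (if (s < t)%R then (t - s)%:E else 0) = (t - s)%:E :> \bar R.
    by case: ltP => // ts; rewrite (@le_anti _ _ s t) ?subrr// st.
  rewrite -!EFinM -EFinB; congr EFin.
  by rewrite /G; field; exact: lt0r_neq0.
- apply: filterS Gf; first exact: (ae_filter_ringOfSetsType lebesgue_measure).
  move=> t Gf /Gf {Gf}Gf; rewrite phiE.
  have -> : (2 * K * f t - K = (2 * K) *: f t + (- K) *: 1)%R.
    by rewrite /GRing.scale/= mulr1.
  by apply: is_deriveD; apply: is_deriveZ.
Qed.

Import HBNNSimple.

(** The integral of a nonnegative function is the supremum of those of the simple
    functions below it, and cutting a simple function to the complement of a null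
    set preserves its integral.  The comparison thus holds for arbitrary f and g,
    which serves to replace [derive1], with its default values, by a measurable
    speed. *)
Lemma ae_ge0_le_lower_integral d (T : measurableType d) (R : realType)
    (mu : {measure set T -> \bar R}) (D : set T) (f g : T -> \bar R) :
  measurable D -> (forall x, D x -> 0 <= f x) -> (forall x, D x -> 0 <= g x) ->
  {ae mu, forall x, D x -> f x <= g x} ->
  \int[mu]_(x in D) f x <= \int[mu]_(x in D) g x.
Proof.
move=> mD f0 g0 [N [mN N0 fgN]].
rewrite !ge0_integralE//; apply: ub_ereal_sup => _ [h /= hf <-].
have mNC : measurable (~` N) by exact: measurableC.
pose k := proj_nnsfun h mNC.
have kE x : k x = (h x * \1_(~` N) x)%R by [].
have -> : sintegral mu h = sintegral mu k.
  rewrite -!integralT_nnsfun; apply: ge0_ae_eq_integral => //.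
  - by apply/measurable_EFinP; exact: measurable_funP.
  - by apply/measurable_EFinP; exact: measurable_funP.
  - by move=> x _; rewrite lee_fin.
  - by move=> x _; rewrite lee_fin.
  exists N; split => // x /= hk; apply: contrapT => Nx; apply: hk => _.
  by rewrite /= mindicE mem_set ?mulr1.
apply: ereal_sup_ubound; exists k => // x.
rewrite kE; have [Nx|Nx] := pselect (N x).
  rewrite indicE memNset; last by move=> /(_ Nx).
  rewrite mulr0 patchE; case: ifPn => // /set_mem; exact: g0.
rewrite indicE mem_set ?mulr1//; apply: (le_trans (hf x)).
rewrite !patchE; case: ifPn => // /set_mem Dx.
by apply: contrapT => /= fg; apply: Nx; apply: fgN => /= /(_ Dx).
Qed.

Lemma ae_ge0_eq_lower_integral d (T : measurableType d) (R : realType)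
    (mu : {measure set T -> \bar R}) (D : set T) (f g : T -> \bar R) :
  measurable D -> (forall x, D x -> 0 <= f x) -> (forall x, D x -> 0 <= g x) ->
  {ae mu, forall x, D x -> f x = g x} ->
  \int[mu]_(x in D) f x = \int[mu]_(x in D) g x.
Proof.
move=> mD f0 g0 fg; apply/eqP; rewrite eq_le; apply/andP; split;
  apply: ae_ge0_le_lower_integral => //.
- by apply: filterS fg => x fg /fg ->.
- by apply: filterS fg => x fg /fg ->.
Qed.

Lemma lipschitz_density (R : realType) (d : nat) (g : R -> 'rV[R]_d) (K : R) :
  (forall s t, enorm (g s - g t) <= K * `|s - t|)%R ->
  exists psi : R -> 'rV[R]_d, [/\
    forall i, measurable_fun setT (fun t => psi t ord0 i),
    forall i, lebesgue_measure.-integrable `[0%R, 1%R] (fun t => (psi t ord0 i)%:E),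
    forall i s t, (0 <= s)%R -> (s <= t)%R -> (t <= 1)%R ->
      (g t ord0 i - g s ord0 i)%:E =
      \int[lebesgue_measure]_(x in `]s, t]) (psi x ord0 i)%:E &
    {ae lebesgue_measure, forall t : R, (0 < t < 1)%R ->
      derivable g t (1 : R)%R /\ derive1 g t = psi t}].
Proof.
move=> gK.
have coordK i s t : (`|g s ord0 i - g t ord0 i| <= K * `|s - t|)%R.
  apply: le_trans (gK s t); apply: le_trans (coord_le_enorm _ i).
  by rewrite !mxE.
have /choice [f fP] i := lipschitz_density_scalar (coordK i).
exists (fun t => \row_i f i t)%R; split => [i|i|i s t s0 st t1|] /=.
- have [mf _ _ _] := fP i.
  by apply: (eq_measurable_fun (f i)) mf => x _; rewrite mxE.
- have [_ if_ _ _] := fP i.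
  by apply: eq_integrable if_ => // x _; rewrite mxE.
- have [_ _ fE _] := fP i; rewrite fE//.
  by apply: eq_integral => x _; rewrite mxE.
have aeF := ae_filter_ringOfSetsType (@lebesgue_measure R).
have : {ae lebesgue_measure, forall (t : R) (i : 'I_d), (0 < t < 1)%R ->
    is_derive t (1 : R)%R (fun x => g x ord0 i) (f i t)}.
  by apply: (@filter_forall _ _ (fun (i : 'I_d) (t : R) => (0 < t < 1)%R ->
    is_derive t (1 : R)%R (fun x => g x ord0 i) (f i t)) _ aeF) => i; have [] := fP i.
apply: filterS => t ft t01.
have gt : derivable g t (1 : R)%R.
  by apply/derivable_mxP => i j; rewrite ord1; have [] := ft j t01.
split => //; rewrite derive1E (derive_mx gt).
apply/matrixP => i j; rewrite ord1 !mxE.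
by have /@derive_val := ft j t01.
Qed.

(** * The distance-to-measure *)

Lemma nondecreasing_emeasurable (R : realType) (D : set R) (f : R -> \bar R) :
  measurable D -> {homo f : x y / (x <= y)%R >-> x <= y} -> measurable_fun D f.
Proof.
move=> mD fh; apply: (measurability _ (ErealGenOInfty.measurableE R)).
move=> /= _ [_ [a ->]] <-; apply: measurableI => //.
rewrite preimage_itvoy; apply: is_interval_measurable => s t /= fs ft u /andP[su ut].
by rewrite /= (lt_le_trans fs)// fh.
Qed.

Section delta.
Context (R : realType) (d : nat) (mu : probability (borelRd R d) R).
Implicit Types (x z : 'rV[R]_d) (u v r : R).

Lemma open_eball x r : open (eball x r).
Proof.
rewrite (_ : eball x r = (fun y => enorm (y - x)%R) @^-1` `]-oo, r[%classic); last first.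
  by apply/seteqP; split => y; rewrite /eball/= in_itv.
apply: open_comp; last exact: interval_open.
move=> y _; apply: (@continuous_comp _ _ _ (fun y : 'rV[R]_d => y - x)%R (@enorm R d) y).
  by apply: continuousB => e; [exact: id|exact: cst_continuous].
exact: continuous_enorm.
Qed.

Lemma measurable_eball x r : measurable (eball x r : set (borelRd R d)).
Proof. by apply: sub_sigma_algebra; exact: open_eball. Qed.
Hint Resolve measurable_eball : core.

Lemma delta_ge0 u x : 0 <= delta mu u x.
Proof. by apply: le_ereal_inf_tmp => _ [r [r0 _] <-]; rewrite lee_fin ltW. Qed.

Lemma delta_homo x : {homo (fun u => delta mu u x) : u v / (u <= v)%R >-> u <= v}.
Proof.
move=> u v uv; apply: ereal_inf_le_tmp => _ [r [r0 vr] <-].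
by exists r => //; split => //; apply: le_lt_trans vr; rewrite lee_fin.
Qed.

Lemma eball_exhaust u x : (u < 1)%R -> exists2 r, (0 < r)%R & u%:E < mu (eball x r).
Proof.
move=> u1.
have nd : nondecreasing_seq (fun n => eball x n%:R).
  move=> a b ab; apply/subsetPset => y; rewrite /eball/= => /lt_le_trans; apply.
  by rewrite ler_nat.
have bT : \bigcup_n eball x n%:R = setT.
  rewrite -subTset => y _; exists (Num.bound (enorm (y - x))) => //.
  by rewrite /eball/=; exact: archi_boundP (enorm_ge0 _).
have := @nondecreasing_cvg_mu _ _ _ mu (fun n => eball x n%:R) (fun=> measurable_eball _ _).
rewrite bT => /(_ measurableT nd).
move=> /cvg_lim mu1.
apply: contrapT => h.
have : (1%:E <= u%:E)%E; last by rewrite lee_fin leNgt u1.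
rewrite -(probability_setT mu) -[X in X <= _]mu1//; apply: lime_le.
  apply: ereal_nondecreasing_is_cvgn => a b ab; apply: le_measure; rewrite ?inE//.
  by apply/subsetPset/nd.
near=> n.
rewrite /= leNgt; apply/negP => un; apply: h.
by exists n%:R => //; rewrite ltr0n; near: n; exact: nbhs_infty_gt.
Unshelve. all: by end_near. Qed.

Lemma delta_fin u x : (u < 1)%R -> delta mu u x \is a fin_num.
Proof.
move=> /(eball_exhaust x) [r r0 ur]; rewrite ge0_fin_numE ?delta_ge0//.
apply: (@le_lt_trans _ _ r%:E); last by rewrite ltry.
by apply: ereal_inf_lbound; exists r.
Qed.

Lemma delta_lip u x z : delta mu u z <= delta mu u x + (enorm (z - x))%:E.
Proof.
rewrite -leeBlDr//; apply: le_ereal_inf_tmp => _ [r [r0 ur] <-].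
rewrite leeBlDr// -EFinD; apply: ereal_inf_lbound; exists (r + enorm (z - x))%R => //.
split; first by rewrite ltr_wpDr ?enorm_ge0.
apply: (lt_le_trans ur); apply: le_measure; rewrite ?inE//.
move=> y; rewrite /eball/= => yr.
rewrite (le_lt_trans (ler_enorm_distD x _ _))// enormB.
by rewrite enormB ltr_leD// enormB.
Qed.

Lemma delta_lt u x r : delta mu u x < r%:E -> u%:E < mu (eball x r).
Proof.
move=> /ereal_inf_lt[_ [s [s0 us] <-]]; rewrite lte_fin => sr.
apply: (lt_le_trans us); apply: le_measure; rewrite ?inE//.
by move=> y; rewrite /eball/= => /lt_trans; apply.
Qed.

End delta.

Lemma le_poweR (R : realType) (a b : \bar R) (q : R) : (0 <= q)%R -> 0 <= a -> a <= b -> a `^ q <= b `^ q.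
Proof.
move=> q0 a0 ab; apply: gt0_ler_poweR => //; rewrite in_itv/= leey andbT//.
exact: le_trans ab.
Qed.

Section dtm.
Context (R : realType) (d : nat) (mu : probability (borelRd R d) R) (m p : R).
Hypotheses (m_gt0 : (0 < m)%R) (m_le1 : (m <= 1)%R) (p_ge1 : (1 <= p)%R).
Implicit Types (x z : 'rV[R]_d) (u v r : R).
Notation leb := (@lebesgue_measure R).

Let p_gt0 : (0 < p)%R. Proof. exact: lt_le_trans p_ge1. Qed.
Let pV_gt0 : (0 < p^-1)%R. Proof. by rewrite invr_gt0. Qed.

Lemma poweRVK (a : \bar R) : 0 <= a -> (a `^ p^-1) `^ p = a.
Proof. by move=> a0; rewrite -poweRrM mulVf ?gt_eqF// poweRe1. Qed.

Lemma dtm_ge0 x : 0 <= dtm m p mu x.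
Proof. exact: poweR_ge0. Qed.

Lemma measurable_delta_pow x (D : set (measurableTypeR R)) :
  measurable D -> measurable_fun D (fun u => delta mu u x `^ p).
Proof.
move=> mD.
have h : {homo (fun u => delta mu u x `^ p) : u v / (u <= v)%R >-> u <= v}.
  move=> u v uv; apply: le_poweR; rewrite ?delta_ge0//; first exact: ltW.
  exact: delta_homo.
exact: nondecreasing_emeasurable h.
Qed.

(** Markov inequality: if the ball of radius 3r had mass at most m/4, then delta
    would be at least 3r on [m/4, m], and the mean of delta^p over [0, m] would
    be at least 3/4 (3r)^p, which exceeds r^p for every p >= 1. *)
Lemma dtm_mass x r : (0 < r)%R -> dtm m p mu x <= r%:E ->
  (m / 4)%:E < mu (eball x (3 * r)).
Proof.
move=> r0 xr; apply: delta_lt; rewrite ltNge; apply/negP => hd.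
pose I := \int[leb]_(u in `[0%R, m]) (delta mu u x `^ p).
have I0 : 0 <= I by apply: integral_ge0 => u _; exact: poweR_ge0.
have : m^-1%:E * I <= (r `^ p)%:E.
  have mI0 : 0 <= m^-1%:E * I by rewrite mule_ge0// lee_fin invr_ge0 ltW.
  rewrite -(poweRVK mI0) -poweR_EFin; apply: le_poweR => //; first exact: ltW.
  exact: poweR_ge0.
apply/negP; rewrite -ltNge.
have hI : ((3 * r) `^ p * (m * 3 / 4))%:E <= I.
  have mI : measurable (`[(m / 4)%R, m]%classic : set (measurableTypeR R)) by exact: measurable_itv.
  have m4 : (m / 4 < m)%R by rewrite ltr_pdivrMr// ltr_pMr// ltr1n.
  apply: (@le_trans _ _ (\int[leb]_(u in `[(m / 4)%R, m]) (delta mu u x `^ p))); last first.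
    apply: ge0_subset_integral => //.
    - exact: measurable_delta_pow.
    - by move=> u _; exact: poweR_ge0.
    - move=> u /=; rewrite !in_itv/= => /andP[h ->]; rewrite andbT.
      by apply: le_trans h; rewrite divr_ge0// ltW.
  apply: (@le_trans _ _ (\int[leb]_(u in `[(m / 4)%R, m]) (cst ((3 * r) `^ p)%:E u))).
    rewrite integral_cst//= lebesgue_measure_itv/= lte_fin m4.
    rewrite -EFinB -EFinM lee_fin ler_wpM2l ?powR_ge0//; lra.
  apply: ge0_le_integral => //.
  - by move=> u _; rewrite lee_fin powR_ge0.
  - exact: measurable_delta_pow.
  - move=> u /=; rewrite in_itv/= => /andP[mu4 um].
    rewrite -poweR_EFin; apply: le_poweR; first exact: ltW.
      by rewrite lee_fin mulr_ge0// ltW.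
    apply: le_trans hd _; exact: delta_homo.
apply: (@lt_le_trans _ _ (m^-1%:E * ((3 * r) `^ p * (m * 3 / 4))%:E)); last first.
  by rewrite lee_wpmul2l// lee_fin invr_ge0 ltW.
rewrite -EFinM lte_fin powRM ?(ltW r0)//.
have -> : (m^-1 * (3 `^ p * r `^ p * (m * 3 / 4)) = r `^ p * (3 `^ p * (3 / 4)))%R.
  by field; exact: lt0r_neq0.
rewrite ltr_pMr ?powR_gt0//.
have : (3 `^ 1 <= 3 `^ p :> R)%R by apply: ler_powR => //; rewrite ler1n.
rewrite powRr1//; lra.
Qed.

Lemma dtm_fin x : (m < 1)%R -> dtm m p mu x \is a fin_num.
Proof.
move=> m1; rewrite ge0_fin_numE ?dtm_ge0//; apply: poweR_lty.
apply: lte_mul_pinfty; rewrite ?lee_fin ?invr_ge0 ?(ltW m_gt0)//.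
apply: (@le_lt_trans _ _ (\int[leb]_(u in `[0%R, m]) (cst (delta mu m x `^ p) u))).
  apply: ge0_le_integral => //.
  - by move=> u _; exact: poweR_ge0.
  - exact: measurable_delta_pow.
  - move=> u /=; rewrite in_itv/= => /andP[u0 um].
    by apply: le_poweR; [exact: ltW|exact: delta_ge0|exact: delta_homo].
rewrite integral_cst//= lebesgue_measure_itv/= lte_fin m_gt0 sube0.
apply: lte_mul_pinfty; [exact: poweR_ge0| |exact: ltry].
exact/fin_num_poweR/delta_fin.
Qed.

(** [delta] is 1-Lipschitz in x for each u, and Minkowski inequality transfers
    this to its normalised L^p norm. *)
Lemma dtm_lip x z : dtm m p mu z <= dtm m p mu x + (enorm (z - x))%:E.
Proof.
pose h := enorm (z - x).
have h0 : (0 <= h)%R by exact: enorm_ge0.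
pose I : set (measurableTypeR R) := `[0%R, m[%classic.
have mI : measurable I by exact: measurable_itv.
(* On [0, m[ delta is finite, even for m = 1, and the endpoint m has measure 0. *)
pose dl y : R -> R := (fun u => fine (delta mu u y)) \_ I.
pose c : R -> R := (cst h) \_ I.
have mdl y : measurable_fun setT (dl y).
  apply/(measurable_restrictT _ _).1 => //.
  apply: measurableT_comp => //; apply: nondecreasing_emeasurable => //.
  exact: delta_homo.
have mc : measurable_fun setT c.
  by apply/(measurable_restrictT _ _).1.
have Iu u : I u -> (u < 1)%R.
  by rewrite /I/= in_itv/= => /andP[_ um]; exact: lt_le_trans m_le1.
have dfin y u : (u < 1)%R -> (fine (delta mu u y))%:E = delta mu u y.
  by move=> u1; rewrite fineK// delta_fin.
pose k := ((m^-1)%:E `^ p^-1).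
have NE (f : R -> R) (F : R -> \bar R) : measurable_fun setT (f \_ I) ->
    (forall u, I u -> (0 <= f u)%R /\ (f u)%:E = F u) ->
    (m^-1%:E * \int[leb]_(u in `[0%R, m]) (F u `^ p)) `^ p^-1 = k * 'N[leb]_p%:E[EFin \o (f \_ I)].
  move=> mf fF; rewrite poweRM ?lee_fin ?invr_ge0 ?(ltW m_gt0)//; last first.
    by apply: integral_ge0 => u _; exact: poweR_ge0.
  congr (_ * _); rewrite unlock; congr (_ `^ _).
  have fFE : (fun u => F u `^ p) \_ I = (fun u => `|(EFin \o (f \_ I)) u| `^ p).
    apply/funext => u; rewrite /= !patchE; case: ifPn => [/set_mem uI|_].
      by have [fu0 <-] := fF u uI; rewrite ger0_norm.
    by rewrite normr0 powR0// gt_eqF.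
  rewrite -fFE -integral_mkcond -integral_itv_bndo_bndc//.
  apply/(measurable_restrictT _ mI); rewrite fFE.
  apply: (measurableT_comp (measurable_poweR p)); apply: measurableT_comp => //.
  exact/measurable_EFinP.
have -> : dtm m p mu z = k * 'N[leb]_p%:E[EFin \o dl z].
  by apply: (NE _ (delta mu ^~ z) (mdl z)) => u /Iu u1; rewrite dfin// fine_ge0 ?delta_ge0.
have -> : dtm m p mu x = k * 'N[leb]_p%:E[EFin \o dl x].
  by apply: (NE _ (delta mu ^~ x) (mdl x)) => u /Iu u1; rewrite dfin// fine_ge0 ?delta_ge0.
have -> : h%:E = k * 'N[leb]_p%:E[EFin \o c].
  rewrite -(NE _ (cst h%:E))//.
  rewrite integral_cst//= lebesgue_measure_itv/= lte_fin m_gt0 sube0.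
  have -> : m^-1%:E * ((h `^ p)%:E * m%:E) = h%:E `^ p.
    by rewrite -!EFinM mulrCA mulVf ?gt_eqF// mulr1.
  by rewrite -poweRrM mulfV ?gt_eqF// poweRe1.
rewrite -ge0_muleDr ?Lnorm_ge0//; apply: lee_wpmul2l; first exact: poweR_ge0.
apply: le_trans (minkowski_EFin leb (mdl x) mc p_ge1).
rewrite unlock; apply: le_poweR; first exact: ltW.
  by apply: integral_ge0 => u _; exact: poweR_ge0.
have dl0 y u : (0 <= dl y u)%R.
  by rewrite /dl patchE; case: ifPn => // _; rewrite fine_ge0 ?delta_ge0.
have c0 u : (0 <= c u)%R by rewrite /c patchE; case: ifPn.
have mpow (f : R -> R) : measurable_fun setT f ->
    measurable_fun setT (fun u => `|(EFin \o f) u| `^ p).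
  move=> mf; apply: (measurableT_comp (measurable_poweR p)).
  by apply: measurableT_comp => //; exact/measurable_EFinP.
apply: ge0_le_integral => //.
- by move=> u _; exact: poweR_ge0.
- exact: mpow.
- by apply: mpow; exact: measurable_funD.
move=> u _; apply: le_poweR; [exact: ltW|exact: abse_ge0|].
have dlE (y : 'rV[R]_d) w : dl y w = if w \in I then fine (delta mu w y) else 0%R.
  by rewrite /dl patchE.
have cE w : c w = if w \in I then h else 0%R by rewrite /c patchE.
rewrite /comp !gee0_abs ?lee_fin ?addr_ge0//= !dlE cE.
case: ifPn => [/set_mem/Iu u1|_]; last by rewrite addr0.
by rewrite -lee_fin EFinD !dfin// delta_lip.
Qed.

End dtm.

(** * Covering the low levels *)

Lemma maximal_separated_family (T : eqType) (P : T -> Prop) (sep : rel T) (N : nat) :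
  (forall s : seq T, {in s, forall x, P x} -> pairwise sep s -> (size s <= N)%N) ->
  exists s : seq T, [/\ {in s, forall x, P x}, pairwise sep s &
    forall z, P z -> exists2 x, x \in s & ~~ sep z x].
Proof.
move=> bnd.
pose Q n := `[< exists s : seq T, [/\ size s = n, {in s, forall x, P x} & pairwise sep s] >].
have Q0 : exists n, Q n by exists 0%N; apply/asboolP; exists [::].
have QN n : Q n -> (n <= N)%N by move=> /asboolP[s [<- Ps ss]]; exact: bnd.
case: (ex_maxnP Q0 QN) => n /asboolP[s [sn Ps ss]] nmax.
exists s; split => // z Pz; apply: contrapT => h.
suff /nmax : Q n.+1 by rewrite ltnn.
apply/asboolP; exists (z :: s); split; first by rewrite /= sn.
  by move=> x; rewrite inE => /predU1P[->//|]; exact: Ps.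
rewrite /= ss andbT; apply/allP => x xs; apply/negPn/negP => zx.
by apply: h; exists x.
Qed.

Section cover.
Context (R : realType) (d : nat) (mu : probability (borelRd R d) R) (m p : R).
Hypotheses (m_gt0 : (0 < m)%R) (m_le1 : (m <= 1)%R) (p_ge1 : (1 <= p)%R).
Implicit Types (x z : 'rV[R]_d) (r : R).

(** The balls of radius 3r around 6r-separated points are disjoint, and each of
    them has mass more than m/4. *)
Lemma separated_size r (s : seq 'rV[R]_d) : (0 < r)%R ->
  {in s, forall x, dtm m p mu x <= r%:E} ->
  pairwise (fun x y => 6 * r <= enorm (x - y))%R s ->
  ((size s)%:R * (m / 4) <= 1)%R.
Proof.
move=> r0 sr ss.
pose U (t : seq 'rV[R]_d) := \big[setU/set0]_(x <- t) (eball x (3 * r) : set (borelRd R d)).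
have mU t : measurable (U t).
  rewrite /U; elim/big_ind: _ => [|A B|x _]; first exact: measurable0.
    exact: measurableU.
  exact: measurable_eball.
suff h : ((size s)%:R * (m / 4))%:E <= mu (U s).
  by rewrite -lee_fin (le_trans h)// probability_le1.
elim: s sr ss => [|x s IH] sr /=; first by rewrite mul0r.
move=> /andP[/allP xs ss].
have {}IH := IH (fun y ys => sr y (mem_behead (s := x :: s) ys)) ss.
rewrite /U big_cons (measureU mu (measurable_eball x (3 * r)) (mU s)); last first.
  rewrite -subset0 => y [xy]; rewrite /U -bigcup_seq => -[z /= zs zy].
  have := xs _ zs; apply/negP; rewrite -ltNge.
  rewrite (le_lt_trans (ler_enorm_distD y _ _))// enormB.
  move: xy zy; rewrite /eball/=; lra.
rewrite -natr1 mulrDl mul1r addrC EFinD; apply: leeD; last exact: IH.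
by apply: ltW; apply: (dtm_mass m_gt0 p_ge1) => //; apply: sr; rewrite mem_head.
Qed.

Let natbound (n : nat) : (n%:R * (m / 4) <= 1)%R -> (n <= Num.bound (4 / m))%N.
Proof.
move=> h; rewrite -(ler_nat R); apply: ltW.
apply: (@le_lt_trans _ _ (4 / m)%R); last first.
  by apply: archi_boundP; rewrite divr_ge0// ltW.
by rewrite ler_pdivlMr// -[leRHS]mulr1 -ler_pdivrMl// mulrC -mulrA.
Qed.

Lemma dtm_cover r (P : 'rV[R]_d -> Prop) : (0 < r)%R ->
  (forall z, P z -> dtm m p mu z <= r%:E) ->
  exists s : seq 'rV[R]_d, [/\ ((size s)%:R * (m / 4) <= 1)%R,
    {in s, forall x, P x} &
    forall z, P z -> exists2 x, x \in s & (enorm (z - x) <= 6 * r)%R].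
Proof.
move=> r0 Pr.
have [|s [Ps ss cov]] := @maximal_separated_family _ P
    (fun x y => 6 * r <= enorm (x - y))%R (Num.bound (4 / m)).
  move=> s Ps ss; apply: natbound; apply: separated_size ss => //.
  by move=> x /Ps; exact: Pr.
exists s; split => //.
  by apply: separated_size ss => // x /Ps; exact: Pr.
move=> z /cov[x xs]; rewrite -ltNge => /ltW zx; by exists x.
Qed.

Lemma uniq_separated (s : seq 'rV[R]_d) : uniq s ->
  exists2 e, (0 < e)%R & pairwise (fun x y => e <= enorm (x - y))%R s.
Proof.
elim: s => [_|x s IH]; first by exists 1%R.
move=> /= /andP[xs /IH[e e0 es]].
have [f f0 /allP fx] : exists2 f, (0 < f)%R & all (fun y => f <= enorm (x - y))%R s.
  elim: s {IH es} xs => [_|y s IH]; first by exists 1%R.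
  rewrite inE negb_or => /andP[xy /IH[f f0 fs]].
  exists (Num.min f (enorm (x - y))) => /=.
    rewrite lt_min f0 lt_neqAle enorm_ge0 andbT eq_sym/=.
    by apply: contra_neq xy => /enorm_eq0/eqP; rewrite subr_eq0 => /eqP.
  rewrite ge_min lexx orbT/=; apply: sub_all fs => z fz.
  by rewrite ge_min fz.
exists (Num.min e f); first by rewrite lt_min e0.
apply/andP; split; first by apply/allP => y /fx fy; rewrite ge_min fy orbT.
by apply: sub_pairwise es => y z ez; rewrite ge_min ez.
Qed.

(** Finitely many zeros are 6r-separated for some r > 0, so the bound of
    [separated_size] applies to any list of zeros. *)
Lemma dtm_zeros_finite : exists s : seq 'rV[R]_d, forall z, dtm m p mu z = 0 -> z \in s.
Proof.
have [|s [_ _ cov]] := @maximal_separated_family _ (fun z : 'rV[R]_d => dtm m p mu z = 0)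
    (fun x y => x != y) (Num.bound (4 / m)).
  move=> s Ps ss; apply: natbound.
  have [|e e0 es] := @uniq_separated s; first by rewrite uniq_pairwise.
  have e6 : (0 < e / 6)%R by rewrite divr_gt0.
  apply: (separated_size e6).
    by move=> x /Ps ->; rewrite lee_fin ltW.
  by rewrite mulrC divfK.
exists s => z /cov[x xs]; by rewrite negbK => /eqP ->.
Qed.

End cover.

(** * Length from shortcuts *)

Lemma closed_min_max (R : realType) (A : set R) : closed A -> A !=set0 ->
  A `<=` `[0%R, 1%R] ->
  exists s t, [/\ A s, A t & forall x, A x -> (s <= x <= t)%R].
Proof.
move=> cA A0 A01.
have kA : compact A by apply: subclosed_compact A01 => //; exact: segment_compact.
have cid_ : {within A, continuous (id : R -> R)} by apply: continuous_subspaceT => x; exact: id.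
have [s /set_mem As smin] := compact_EVT_min A0 kA cid_.
have [t /set_mem At tmax] := compact_EVT_max A0 kA cid_.
by exists s, t; split => // x Ax; rewrite smin ?tmax// inE.
Qed.

Lemma measure_seq_cover (R : realType) (I : eqType) d (M : measurableType d)
    (nu : {measure set M -> \bar R}) (A : set M) (s : seq I) (B : I -> set M) (c : R) :
  measurable A -> (forall i, measurable (B i)) -> (forall i, i \in s -> nu (B i) <= c%:E) ->
  A `<=` [set x | exists2 i, i \in s & B i x] -> nu A <= ((size s)%:R * c)%:E.
Proof.
move=> mA mB; elim: s A mA => [|i s IH] A mA Bc AB.
  rewrite mul0r (_ : A = set0) ?measure0// -subset0 => x /AB[//].
have -> : A = (A `&` B i) `|` (A `\` B i) by rewrite setUIDK.
apply: le_trans; first by apply: measureU2; [exact: measurableI|exact: measurableD].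
rewrite /= -natr1 mulrDl mul1r addrC EFinD; apply: leeD; last first.
  apply: le_trans (Bc i (mem_head _ _)); apply: le_measure; rewrite ?inE//.
  exact: measurableI.
apply: IH; first exact: measurableD.
  by move=> j js; apply: Bc; rewrite inE js orbT.
move=> x [/AB[j]]; rewrite inE => /predU1P[->//|js jx _]; by exists j.
Qed.

Lemma lipschitz_continuous (R : realType) (V : normedModType R) (h : R -> V) (L : R) :
  (forall s t, `|h s - h t| <= L * `|s - t|)%R -> continuous h.
Proof.
move=> hL x; apply/cvgrPdist_lt => e e0; near=> y.
have L1 : (0 < `|L| + 1)%R by rewrite ltr_wpDl.
apply: le_lt_trans (hL x y) _.
apply: (@le_lt_trans _ _ ((`|L| + 1) * `|x - y|)%R).
  by rewrite ler_wpM2r// (le_trans (ler_norm L))// lerDl.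
rewrite mulrC -ltr_pdivlMr//; near: y.
have eL : (0 < e / (`|L| + 1))%R by rewrite divr_gt0.
exact: (@cvgr_dist_lt _ _ _ _ (nbhs_filter x) id x cvg_id _ eL).
Unshelve. all: by end_near. Qed.

Lemma closed_sublevel (R : realType) (h : R -> R) (c : R) : continuous h -> closed [set t | (h t <= c)%R].
Proof.
move=> ch; rewrite (_ : [set t | _] = h @^-1` `]-oo, c]%classic).
  by apply: closed_comp => // x _; exact: ch.
by apply/seteqP; split => x; rewrite /= in_itv.
Qed.

Lemma closed_curve_ball (R : realType) (d : nat) (G : R -> 'rV[R]_d) (K : R) z r :
  (forall s t, enorm (G s - G t) <= K * `|s - t|)%R ->
  closed [set t | (enorm (G t - z) <= r)%R].
Proof.
move=> GK; apply: (closed_sublevel (h := fun t => enorm (G t - z))%R).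
apply: (lipschitz_continuous (L := K)) => s t.
apply: le_trans (GK s t); apply: le_trans (ler_dist_enorm _ _) _.
by rewrite opprB addrA subrK.
Qed.

Lemma closed_curve_fiber (R : realType) (d : nat) (G : R -> 'rV[R]_d) (K : R) z :
  (forall s t, enorm (G s - G t) <= K * `|s - t|)%R ->
  closed [set t | G t = z].
Proof.
move=> GK; rewrite (_ : [set t | _] = [set t | (enorm (G t - z) <= 0)%R]).
  exact: closed_curve_ball GK.
apply/seteqP; split => t /=; first by move=> ->; rewrite subrr enorm0.
move=> Gz; apply/eqP; rewrite -subr_eq0; apply/eqP/enorm_eq0/eqP.
by rewrite eq_le Gz enorm_ge0.
Qed.

(** The setting is a curve G with stop times T and an abstract length measure
    nu: length is distance inside the gaps ([nu_gap]), and between two stops the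
    length spent above level c is bounded by the energy of the segment joining
    them ([shortcut]). *)
Section length_from_shortcuts.
Context (R : realType) (d : nat) (mu : probability (borelRd R d) R) (m p : R).
Hypotheses (m_gt0 : (0 < m)%R) (m_le1 : (m <= 1)%R) (p_ge1 : (1 <= p)%R).
Variable D : 'rV[R]_d -> R.
Hypothesis DE : forall z, dtm m p mu z = (D z)%:E.
Variables (G : R -> 'rV[R]_d) (K : R) (T : set R).
Hypothesis GK : forall s t, (enorm (G s - G t) <= K * `|s - t|)%R.
Hypothesis closedT : closed T.
Hypothesis T01 : T `<=` `[0%R, 1%R].
Hypotheses (T0 : T 0%R) (T1 : T 1%R).
Variable nu : {measure set (measurableTypeR R) -> \bar R}.
Let f (t : R) : R := D (G t).
Definition gap (S : set R) a b := [/\ S a, S b, (a < b)%R & forall s, (a < s < b)%R -> ~ S s].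
Hypothesis nu1 : forall t, nu [set t] = 0.
Hypothesis nu_gap : forall a b s t, gap T a b -> (a <= s)%R -> (s <= t)%R -> (t <= b)%R ->
  nu `]s, t]%classic = (enorm (G t - G s))%:E.

Lemma D_lip x z : (D z <= D x + enorm (z - x))%R.
Proof. by rewrite -lee_fin EFinD -(DE z) -(DE x); exact: dtm_lip. Qed.

Lemma dtm_curve_lip s t : (`|f s - f t| <= K * `|s - t|)%R.
Proof.
apply: le_trans (GK s t); rewrite ler_norml.
have := D_lip (G s) (G t); have := D_lip (G t) (G s).
by rewrite enormB /f; lra.
Qed.

Let cf : continuous f. Proof. exact: lipschitz_continuous dtm_curve_lip. Qed.

Let mclosed (A : set R) : closed A -> measurable (A : set (measurableTypeR R)).
Proof. exact: closed_measurable. Qed.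

Let mlow c : measurable ([set t | (f t <= c)%R] : set (measurableTypeR R)).
Proof. by apply: mclosed; exact: closed_sublevel. Qed.

Let mhigh c : measurable ([set t | (c < f t)%R] : set (measurableTypeR R)).
Proof.
rewrite (_ : [set t | _] = ~` [set t | (f t <= c)%R]).
  by apply: measurableC; exact: mlow.
by apply/seteqP; split => t /=; rewrite ltNge => /negP.
Qed.

Let mitv (i : interval R) : measurable ([set` i] : set (measurableTypeR R)).
Proof. exact: measurable_itv. Qed.

Let nu_cc s t : (s <= t)%R -> nu `[s, t]%classic = nu `]s, t]%classic.
Proof.
move=> st; rewrite -(@setU1itv _ _ _ _ false) ?bnd_simp//.
have ms : measurable ([set s] : set (measurableTypeR R)) by exact: measurable_set1.
rewrite (measureU nu ms (mitv _)); first by rewrite [X in X + _]nu1 add0e.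
by rewrite -subset0 => x [-> /=]; rewrite in_itv/= ltxx.
Qed.

Lemma gap_exists t : (0 <= t <= 1)%R -> T t \/ exists a b, gap T a b /\ (a < t < b)%R.
Proof.
move=> /andP[t0 t1]; have [Tt|nTt] := pselect (T t); [by left|right].
have [|||a' [a [_ [Ta /= at_] amax]]] := @closed_min_max R (T `&` [set x | (x <= t)%R]).
- by apply: closedI => //; exact: closed_sublevel.
- by exists 0%R.
- by move=> x [Tx _]; exact: T01.
have [|||b [b' [[Tb /= tb] _ bmin]]] := @closed_min_max R (T `&` [set x | (t <= x)%R]).
- by apply: closedI => //; exact: closed_ge.
- by exists 1%R.
- by move=> x [Tx _]; exact: T01.
have at' : (a < t)%R by rewrite lt_neqAle at_ andbT; apply: contra_notN nTt => /eqP <-.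
have tb' : (t < b)%R by rewrite lt_neqAle tb andbT; apply: contra_notN nTt => /eqP ->.
exists a, b; split; last by rewrite at'.
split => // [|s /andP[as_ sb] Ts]; first exact: lt_trans tb'.
have [st|ts] := leP s t.
  by have /andP[_] := amax s (conj Ts st); rewrite leNgt as_.
by have /andP[+ _] := bmin s (conj Ts (ltW ts)); rewrite leNgt sb.
Qed.

Let gap01 a b : gap T a b -> (0 <= a)%R /\ (b <= 1)%R.
Proof.
by case=> /T01 + /T01 + _ _; rewrite /= !in_itv/= => /andP[-> _] /andP[_ ->].
Qed.

(** A gap is straight, so its part inside a ball of radius 6r has length at most
    12r; and at most 4/m such balls cover the level f <= r. *)
Lemma gap_low a b r : gap T a b -> (0 < r)%R ->
  nu (`]a, b]%classic `&` [set t | (f t <= r)%R]) <= (48 / m * r)%:E.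
Proof.
move=> gab r0.
pose P z := exists2 t, (a < t <= b)%R /\ (f t <= r)%R & G t = z.
have [|s [sz Ps cov]] := dtm_cover m_gt0 p_ge1 (P := P) (mu := mu) r0.
  by move=> z [t [_ tr] <-]; rewrite DE lee_fin.
pose B z := (`[a, b] `&` [set t | (enorm (G t - z) <= 6 * r)%R])%classic.
have cB z : closed (B z) by apply: closedI; [exact: interval_closed|exact: closed_curve_ball GK].
apply: (@le_trans _ _ ((size s)%:R * (12 * r))%:E); last first.
  rewrite lee_fin mulrA ler_pM2r// mulrC -ler_pdivlMl//.
  move: sz; rewrite mulrC -ler_pdivlMl ?divr_gt0// mulr1 invf_div => /le_trans; apply.
  rewrite le_eqVlt; apply/orP; left; apply/eqP; field; exact: lt0r_neq0.
apply: (@measure_seq_cover R _ _ _ nu _ s B).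
- by apply: measurableI; [exact: mitv|exact: mlow].
- by move=> z; exact: mclosed.
- move=> z zs; have [->|/set0P B0] := eqVneq (B z) set0.
    by rewrite measure0 lee_fin mulr_ge0// ltW.
  have [a0 b1] := gap01 gab.
  have [u [v [Bu Bv uv]]] : exists u v, [/\ B z u, B z v & forall x, B z x -> (u <= x <= v)%R].
    apply: closed_min_max => //; move=> x [/= + _]; rewrite !in_itv/= => /andP[ax xb].
    by rewrite (le_trans a0 ax) (le_trans xb b1).
  have /andP[_ uv'] := uv u Bu.
  have [+ uz] := Bu; have [+ vz] := Bv.
  rewrite /= !in_itv/= => /andP[av vb] /andP[au ub].
  apply: (@le_trans _ _ (nu `[u, v]%classic)).
    apply: le_measure; rewrite ?inE; [exact: mclosed|exact: mitv|].
    by move=> x /uv; rewrite /= in_itv.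
  rewrite nu_cc// (nu_gap gab)// lee_fin.
  apply: le_trans (ler_enorm_distD z _ _) _; rewrite (enormB z).
  by move: uz vz; rewrite /=; lra.
- move=> t [/= + tr]; rewrite in_itv/= => /andP[at_ tb].
  have [|x xs xt] := cov (G t); first by exists t; rewrite ?at_.
  by exists x => //; split => //=; rewrite in_itv/= (ltW at_).
Qed.

Definition long r := [set t : R | exists a b, [/\ gap T a b, (a < t < b)%R & (r < enorm (G b - G a))%R]].

Let open_long r : open (long r).
Proof.
have -> : long r = \bigcup_(ab in [set ab : R * R | gap T ab.1 ab.2 /\ (r < enorm (G ab.2 - G ab.1))%R]) `]ab.1, ab.2[%classic.
  apply/seteqP; split => t.
    by move=> [a [b [gab tab rab]]]; exists (a, b) => //=; rewrite in_itv.
  by move=> [[a b] /= [gab rab]]; rewrite in_itv/= => tab; exists a, b.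
by apply: bigcup_open => ab _; exact: interval_open.
Qed.

Let mlong r : measurable (long r : set (measurableTypeR R)).
Proof. by apply: open_measurable; exact: open_long. Qed.

Lemma le_long r s : (r <= s)%R -> long s `<=` long r.
Proof. by move=> rs t [a [b [? ? ?]]]; exists a, b; split => //; exact: le_lt_trans rs _. Qed.

(** The condition on c and r makes the part of level at most c of a gap longer
    than r shorter than r/2, hence shorter than the rest of the gap.  Gaps longer
    than r last at least e > 0 because G is Lipschitz, so an induction on the
    number of steps of duration e in [s, t] removes them one at a time. *)
Lemma long_low_le_high (c r : R) (s t : R) : (0 < c)%R -> (0 < r)%R -> (96 / m * c <= r)%R ->
  T s -> T t -> (s <= t)%R ->
  nu (`]s, t]%classic `&` ([set u | (f u <= c)%R] `&` long r)) <=
  nu (`]s, t]%classic `&` [set u | (c < f u)%R]).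
Proof.
move=> c0 r0 cr.
have mBad : measurable ([set u | (f u <= c)%R] `&` long r : set (measurableTypeR R)).
  by apply: measurableI.
have K1 : (0 < `|K| + 1)%R by rewrite ltr_wpDl.
pose e := (r / (`|K| + 1))%R.
have e0 : (0 < e)%R by rewrite divr_gt0.
have gap_ge a b : gap T a b -> (r < enorm (G b - G a))%R -> (e <= b - a)%R.
  move=> [_ _ ab _] /ltW rab; rewrite ler_pdivrMr// mulrC (le_trans rab)//.
  rewrite (le_trans (GK _ _))// gtr0_norm ?subr_gt0// ler_wpM2r ?subr_ge0 ?(ltW ab)//.
  by rewrite (le_trans (ler_norm K))// lerDl.
have [n] : exists n, (t - s <= n%:R * e)%R.
  exists (Num.bound `|(t - s) / e|%R); rewrite -ler_pdivrMr// (le_trans (ler_norm _))//.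
  by apply: ltW; exact: archi_boundP.
elim: n s t => [|n IH] s t ste Ts Tt st.
  have -> : s = t by apply/eqP; rewrite eq_le st/= -subr_le0 (le_trans ste)// mul0r.
  by rewrite set_itv_ge ?bnd_simp ?ltxx// !set0I !measure0.
have [E0|/set0P[u [/= + [fu [a [b [gab /andP[au ub] rab]]]]]]] :=
    eqVneq (`]s, t]%classic `&` ([set u | (f u <= c)%R] `&` long r)) set0.
  by rewrite E0 measure0.
rewrite in_itv/= => /andP[su ut].
have [Ta Tb ab nT] := gab.
have sa : (s <= a)%R by rewrite leNgt; apply/negP => as_; apply: (nT s) => //; rewrite as_ (lt_trans su ub).
have bt : (b <= t)%R.
  rewrite leNgt; apply/negP => tb; apply: (nT t) => //; rewrite tb andbT.
  exact: lt_le_trans ut.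
have split3 (A : set (measurableTypeR R)) : measurable A ->
    nu (`]s, t]%classic `&` A) = nu (`]s, a]%classic `&` A) + nu (`]a, b]%classic `&` A) + nu (`]b, t]%classic `&` A).
  move=> mA.
  have mIA (i : interval R) : measurable ([set` i] `&` A : set (measurableTypeR R)).
    exact: (measurableI _ _ (mitv i) mA).
  rewrite -(measureU nu (mIA _) (mIA _)); last first.
    by rewrite -subset0 => x [[/= + _] [/= + _]]; rewrite !in_itv/= => /andP[_ xa] /andP[+ _]; rewrite ltNge xa.
  rewrite -(measureU nu (measurableU _ _ (mIA _) (mIA _)) (mIA _)); last first.
    rewrite -subset0 => x [[[/= + _]|[/= + _]] [/= + _]]; rewrite !in_itv/=.
      by move=> /andP[_ xa] /andP[bx _]; have := lt_trans ab bx; rewrite ltNge xa.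
    by move=> /andP[_ xb] /andP[+ _]; rewrite ltNge xb.
  congr (nu _); rewrite -!setIUl; congr (_ `&` _).
  by rewrite -itv_bndbnd_setU ?bnd_simp// ?(ltW ab)// -itv_bndbnd_setU ?bnd_simp// (le_trans sa)// ltW.
rewrite !split3//.
have en : (e <= b - a)%R by exact: gap_ge.
have ns : (n.+1%:R * e = n%:R * e + e)%R by rewrite -natr1 mulrDl mul1r.
apply: leeD; first apply: leeD.
- by apply: IH => //; lra.
- have lowle := gap_low gab c0.
  apply: (@le_trans _ _ (r / 2)%:E).
    apply: le_trans (le_trans lowle _); last by rewrite lee_fin; lra.
    apply: le_measure; rewrite ?inE; [exact: measurableI|exact: measurableI|].
    by move=> x [? []].
  have low_high : nu (`]a, b]%classic `&` [set t | (f t <= c)%R]) +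
      nu (`]a, b]%classic `&` [set t | (c < f t)%R]) = (enorm (G b - G a))%:E.
    rewrite -(nu_gap gab (lexx a) (ltW ab) (lexx b)) -measureU; first last.
    - by rewrite -subset0 => x [[_ /= fx] [_ /=]]; rewrite ltNge fx.
    - exact: measurableI.
    - exact: measurableI.
    congr (nu _); rewrite -setIUr; apply: setIidl => x _ /=.
    by case: (leP (f x) c); [left|right].
  rewrite leNgt; apply/negP => hi.
  have : r%:E < (r / 2)%:E + (r / 2)%:E.
    apply: (@lt_trans _ _ (enorm (G b - G a))%:E); first by rewrite lte_fin.
    rewrite -low_high; apply: lee_ltD => //.
      by rewrite ge0_fin_numE// (le_lt_trans lowle)// ltry.
    by apply: le_trans lowle _; rewrite lee_fin; lra.
  by rewrite -EFinD -splitr ltxx.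
- by apply: IH => //; lra.
Qed.

Lemma nearby_stops t r : (0 <= t <= 1)%R -> (0 <= r)%R -> ~ long r t ->
  exists a b, [/\ T a, T b, (a <= t <= b)%R, (enorm (G a - G t) <= r)%R &
    (enorm (G b - G t) <= r)%R].
Proof.
move=> t01 r0 nlt; have [Tt|[a [b [gab /andP[at_ tb]]]]] := gap_exists t01.
  by exists t, t; split => //; rewrite ?subrr ?enorm0// lexx.
have [Ta Tb ab _] := gab.
have abr : (enorm (G b - G a) <= r)%R.
  by rewrite leNgt; apply/negP => rab; apply: nlt; exists a, b; split => //; rewrite at_.
exists a, b; split; rewrite ?(ltW at_) ?(ltW tb)//.
- rewrite enormB -lee_fin -(nu_gap gab (lexx a) (ltW at_) (ltW tb)).
  apply: (@le_trans _ _ (enorm (G b - G a))%:E); last by rewrite lee_fin.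
  rewrite -(nu_gap gab (lexx a) (ltW ab) (lexx b)).
  apply: le_measure; rewrite ?inE; [exact: mitv|exact: mitv|].
  by move=> x; rewrite /= !in_itv/= => /andP[-> /le_trans->]//; exact: ltW.
- rewrite -lee_fin -(nu_gap gab (ltW at_) (ltW tb) (lexx b)).
  apply: (@le_trans _ _ (enorm (G b - G a))%:E); last by rewrite lee_fin.
  rewrite -(nu_gap gab (lexx a) (ltW ab) (lexx b)).
  apply: le_measure; rewrite ?inE; [exact: mitv|exact: mitv|].
  by move=> x; rewrite /= !in_itv/= => /andP[tx ->]; rewrite (lt_trans at_ tx).
Qed.

Variable beta : R.
Hypothesis shortcut : forall s t C c, T s -> T t -> (s < t)%R -> (0 < c)%R ->
  (forall th, (0 <= th <= 1)%R -> (D (G s + th *: (G t - G s)) <= C)%R) ->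
  (c `^ beta)%:E * nu (`]s, t]%classic `&` [set u | (c < f u)%R]) <=
  (enorm (G t - G s) * C `^ beta)%:E.
Hypothesis nu_fiber : forall z, nu (`[0%R, 1%R]%classic `&` [set t | G t = z]) = 0.
Hypothesis nu_fin : nu `[0%R, 1%R]%classic < +oo.

(** The scale of a time is the larger of its level f and of the length of the gap
    around it. *)
Definition small_scale r := `[0%R, 1%R]%classic `&` [set t | (f t <= r)%R] `\` long r.

Let msmall r : measurable (small_scale r : set (measurableTypeR R)).
Proof.
by apply: measurableD; [apply: measurableI; [exact: mitv|exact: mlow]|exact: mlong].
Qed.

(** With c = mr/192 and an energy of at most 14r (8r)^beta, one ball contributes
    at most 2 * 14r (8r/c)^beta, and there are at most 4/m balls. *)
Definition scale_cst : R := (112 / m * (1536 / m) `^ beta)%R.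

Lemma scale_bound r : (0 < r)%R ->
  nu (small_scale r `\` small_scale (r / 2)%R) <= (scale_cst * r)%:E.
Proof.
move=> r0.
pose c := (m / 192 * r)%R.
have c0 : (0 < c)%R.
  by apply: mulr_gt0 r0; apply: divr_gt0 m_gt0 _; rewrite ltr0n.
have cr : (c <= r / 2)%R.
  rewrite /c mulrC (ler_pM2l r0) ler_pdivrMr ?ltr0n//.
  by apply: le_trans m_le1 _; lra.
have r20 : (0 < r / 2)%R by rewrite divr_gt0.
pose bad := [set u | (f u <= c)%R] `&` long (r / 2)%R.
pose high := [set u | (c < f u)%R].
have mbad : measurable (bad : set (measurableTypeR R)) by apply: measurableI.
pose E := small_scale r `\` small_scale (r / 2)%R.
have mE : measurable (E : set (measurableTypeR R)) by apply: measurableD.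
have Ebh : E `<=` bad `|` high.
  move=> t [[[t01 tr] nlt] nsm]; rewrite /bad /high /=.
  have [fc|fc] := leP (f t) c; [left; split => //|by right].
  apply: contrapT => nl; apply: nsm; split => //; split => //=.
  exact: le_trans cr.
pose P z := exists2 t, E t & G t = z.
have [|s [sz Ps cov]] := dtm_cover m_gt0 p_ge1 (P := P) (mu := mu) r0.
  by move=> z [t [[[_ /= tr] _] _] <-]; rewrite DE lee_fin.
pose k := (28 * (1536 / m) `^ beta * r)%R.
have k0 : (0 <= k)%R by rewrite mulr_ge0 ?mulr_ge0 ?powR_ge0// ltW.
pose B z := E `&` [set t | (enorm (G t - z) <= 6 * r)%R].
have mB z : measurable (B z : set (measurableTypeR R)).
  by apply: measurableI => //; apply: mclosed; exact: closed_curve_ball GK.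
apply: (@le_trans _ _ ((size s)%:R * k)%:E); last first.
  have -> : (scale_cst * r = 4 / m * k)%R.
    by rewrite /scale_cst /k; field; exact: lt0r_neq0.
  rewrite lee_fin ler_wpM2r//.
  by move: sz; rewrite mulrC -ler_pdivlMl ?divr_gt0// mulr1 invf_div.
apply: (@measure_seq_cover R _ _ _ nu _ s B) => //; last first.
  move=> t Et; have [|x xs xt] := cov (G t); first by exists t.
  by exists x.
move=> z /Ps [t0 [[[t01 /= ft0] _] _] Gt0].
have Dz : (D z <= r)%R by rewrite -Gt0.
(* Every visit to the ball around z takes place between the first and the last
   stop at distance at most 7r from z, since a gap of length at most r leads from
   any visit to such stops on both sides. *)
pose Q := T `&` [set u | (enorm (G u - z) <= 7 * r)%R].
have BQ t : B z t -> exists a b, [/\ Q a, Q b & (a <= t <= b)%R].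
  move=> [[[[/= t01' tr] nlt] _] /= tz].
  have [||a [b [Ta Tb atb aG bG]]] := @nearby_stops t r _ _ nlt.
  - by move: t01'; rewrite in_itv.
  - exact: ltW.
  exists a, b; split => //; split => //=.
    by apply: le_trans (ler_enorm_distD (G t) _ _) _; lra.
  by apply: le_trans (ler_enorm_distD (G t) _ _) _; lra.
have [->|/set0P[t1 Bt1]] := eqVneq (B z) set0; first by rewrite measure0 lee_fin.
have [a1 [b1 [Qa1 Qb1 _]]] := BQ _ Bt1.
have [|||u [v [[Tu /= uz] [Tv /= vz] uv]]] := @closed_min_max R Q.
- by apply: closedI => //; exact: closed_curve_ball GK.
- by exists a1.
- by move=> x [Tx _]; exact: T01.
have Buv : B z `<=` `[u, v]%classic.
  move=> t /BQ[a [b [/uv/andP[ua _] /uv/andP[_ bv] /andP[at_ tb]]]].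
  by rewrite /= in_itv/= (le_trans ua at_) (le_trans tb bv).
have uv' : (u <= v)%R by have /andP[ua /(le_trans ua)] := uv _ Qa1.
have high_le : nu (`]u, v]%classic `&` high) <= (k / 2)%:E.
  have [->|nuv] := eqVneq u v.
    by rewrite set_itv_ge ?bnd_simp ?ltxx// set0I measure0 lee_fin divr_ge0.
  have ltuv : (u < v)%R by rewrite lt_neqAle nuv.
  have cb : (0 < c `^ beta)%R by exact: powR_gt0.
  rewrite -(@lee_pmul2l _ (c `^ beta)%:E)// ?lte_fin//.
  apply: le_trans (shortcut (C := (8 * r)%R) Tu Tv ltuv c0 _) _.
    move=> th /andP[th0 th1].
    apply: le_trans (D_lip z _) _.
    have : (enorm (G u + th *: (G v - G u) - z) <= 7 * r)%R; last by lra.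
    have -> : (G u + th *: (G v - G u) - z = (1 - th) *: (G u - z) + th *: (G v - z))%R.
      by rewrite !scalerBr !scalerBl !scale1r; apply/rowP => i; rewrite !mxE; ring.
    apply: le_trans (ler_enormD _ _) _; rewrite !enormZ !ger0_norm ?subr_ge0//.
    by nra.
  rewrite -EFinM lee_fin.
  have -> : (c `^ beta * (k / 2) = 14 * r * (8 * r) `^ beta)%R.
    have -> : (8 * r = c * (1536 / m))%R by rewrite /c; field; exact: lt0r_neq0.
    rewrite (powRM _ (ltW c0) (divr_ge0 (ler0n _ _) (ltW m_gt0))) /k.
    by move: ((1536 / m) `^ beta)%R (c `^ beta)%R => X Y; field.
  rewrite ler_wpM2r ?powR_ge0//.
  apply: le_trans (ler_enorm_distD z _ _) _; rewrite (enormB z); lra.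
have m1 : measurable ([set u] : set (measurableTypeR R)) by exact: measurable_set1.
have m2 : measurable (`]u, v]%classic `&` bad : set (measurableTypeR R)).
  exact: (measurableI _ _ (mitv _) mbad).
have m3 : measurable (`]u, v]%classic `&` high : set (measurableTypeR R)).
  exact: (measurableI _ _ (mitv _) (mhigh c)).
apply: (@le_trans _ _ (nu ([set u] `|` ((`]u, v]%classic `&` bad) `|` (`]u, v]%classic `&` high))))).
  apply: le_measure; rewrite ?inE//.
    exact: (measurableU _ _ m1 (measurableU _ _ m2 m3)).
  move=> t Bt; have /= := Buv _ Bt; rewrite in_itv/= => /andP[].
  rewrite le_eqVlt => /predU1P[-> _|ut tv]; [by left|right].
  by case: Bt => /Ebh[] ? _; [left|right]; split => //=; rewrite in_itv/= ut.
apply: le_trans (measureU2 _ m1 (measurableU _ _ m2 m3)) _.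
rewrite [X in X + _](_ : _ = 0) ?add0e; last exact: nu1.
apply: le_trans (measureU2 _ m2 m3) _.
rewrite (splitr k) EFinD; apply: leeD => //.
apply: le_trans high_le.
apply: long_low_le_high => //.
rewrite /c le_eqVlt; apply/orP; left; apply/eqP; field; exact: lt0r_neq0.
Qed.

(** The curve is at one of finitely many points while f = 0, and it has no length
    while it stays at a point. *)
Lemma nu_zeros (A : set R) : measurable (A : set (measurableTypeR R)) ->
  A `<=` `[0%R, 1%R]%classic `&` [set t | f t = 0%R] -> nu A = 0.
Proof.
move=> mA Af; have [s sP] := dtm_zeros_finite mu m_gt0 p_ge1.
apply/eqP; rewrite eq_le measure_ge0 andbT.
apply: (@le_trans _ _ ((size s)%:R * 0)%:E); last by rewrite mulr0.
pose B z := (`[0%R, 1%R]%classic `&` [set t | G t = z]).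
apply: (@measure_seq_cover R _ _ _ nu _ s B) => //.
- move=> z; apply: mclosed; apply: closedI; first exact: interval_closed.
  exact: closed_curve_fiber GK.
- by move=> z _; rewrite nu_fiber.
- move=> t /Af[t01 /= ft]; exists (G t) => //.
  by apply: sP; rewrite DE -/(f t) ft.
Qed.

(** The factor is the partial sum r + r/2 + ... + r / 2^(k-1) = 2 (r - r / 2^k). *)
Lemma small_scale_iter r k : (0 < r)%R ->
  nu (small_scale r) <= (2 * scale_cst * (r - r / 2 ^+ k))%:E + nu (small_scale (r / 2 ^+ k)%R).
Proof.
move=> r0; elim: k => [|k IH].
  by rewrite expr0 divr1 subrr mulr0 add0e.
apply: le_trans IH _.
have rk : (0 < r / 2 ^+ k)%R by rewrite divr_gt0 ?exprn_gt0.
have sub : small_scale (r / 2 ^+ k)%R `<=`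
    (small_scale (r / 2 ^+ k)%R `\` small_scale (r / 2 ^+ k / 2)%R) `|` small_scale (r / 2 ^+ k / 2)%R.
  move=> t ts; have [?|?] := pselect (small_scale (r / 2 ^+ k / 2)%R t); [by right|by left].
have mD := measurableD (msmall (r / 2 ^+ k)%R) (msmall (r / 2 ^+ k / 2)%R).
apply: (@le_trans _ _ ((2 * scale_cst * (r - r / 2 ^+ k))%:E + ((scale_cst * (r / 2 ^+ k))%:E + nu (small_scale (r / 2 ^+ k / 2)%R)))).
  apply: leeD => //; apply: (@le_trans _ _ (nu ((small_scale (r / 2 ^+ k)%R `\` small_scale (r / 2 ^+ k / 2)%R) `|` small_scale (r / 2 ^+ k / 2)%R))).
    apply: le_measure; rewrite ?inE//; exact: measurableU.
  apply: le_trans (measureU2 _ mD (msmall _)) _.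
  by apply: leeD => //; exact: scale_bound.
rewrite addeA -EFinD; have -> : (r / 2 ^+ k / 2 = r / 2 ^+ k.+1)%R.
  by rewrite exprS invfM mulrA mulrAC.
apply: leeD => //; rewrite lee_fin le_eqVlt; apply/orP; left; apply/eqP.
rewrite exprS invfM; field; by rewrite expf_neq0.
Qed.

(** By continuity from above, what remains in the limit is the length of f = 0. *)
Lemma small_scale_bound r : (0 < r)%R -> nu (small_scale r) <= (2 * scale_cst * r)%:E.
Proof.
move=> r0; pose S k := small_scale (r / 2 ^+ k)%R.
have rk k : (0 < r / 2 ^+ k)%R by rewrite divr_gt0 ?exprn_gt0.
have Smono : {homo S : n k / (n <= k)%N >-> (k <= n)%O}.
  move=> n k nk; apply/subsetPset => t [[t01 /= tk] nl].
  have kn : (r / 2 ^+ k <= r / 2 ^+ n)%R.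
    by rewrite ler_pM2l// lef_pV2 ?posrE ?exprn_gt0// ler_eXn2l// ltr1n.
  split; first by split => //=; exact: le_trans kn.
  by apply: contra_not nl; exact: le_long.
have S0 : nu (S 0%N) < +oo.
  apply: le_lt_trans nu_fin; apply: le_measure; rewrite ?inE; [exact: msmall|exact: mitv|].
  by move=> t [[]].
have mI : measurable (\bigcap_k S k : set (measurableTypeR R)).
  by apply: bigcap_measurable => // k _; exact: msmall.
have I0 : nu (\bigcap_k S k) = 0.
  apply: nu_zeros => // t tS; have [[t01 _] _] := tS 0%N I; split => //=.
  apply/eqP; rewrite eq_le; apply/andP; split; last by rewrite -lee_fin -DE dtm_ge0.
  rewrite leNgt; apply/negP => ft.
  pose k := (Num.bound (r / f t))%R.
  have [[_ /= fk] _] := tS k I.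
  have kb : (r / f t < k%:R)%R by apply: archi_boundP; rewrite divr_ge0// ltW.
  have : (r / f t < 2 ^+ k)%R.
    by apply: lt_trans kb _; rewrite -natrX ltr_nat ltn_expl.
  by rewrite ltr_pdivrMr// mulrC -ltr_pdivrMr ?exprn_gt0// ltNge fk.
have cvgS := nonincreasing_cvg_mu S0 (fun k => msmall _) mI Smono.
rewrite I0 in cvgS.
rewrite -[leRHS]adde0 -leeBlDl// -(cvg_lim _ cvgS)//; apply: lime_ge.
  by apply/cvg_ex; exists 0.
near=> k; rewrite leeBlDl//; apply: le_trans (small_scale_iter k r0) _.
apply: leeD => //; rewrite lee_fin ler_wpM2l//; last by rewrite gerBl ltW.
by rewrite mulr_ge0// mulr_ge0 ?powR_ge0// divr_ge0 ?ler0n// ltW.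
Unshelve. all: by end_near. Qed.

(** A gap lies entirely at level M, so [gap_low] bounds its whole length. *)
Lemma length_le_max M : (0 < M)%R ->
  (forall t, (0 <= t <= 1)%R -> (f t <= M)%R) ->
  nu `[0%R, 1%R]%classic <= (2 * scale_cst * (48 / m) * M)%:E.
Proof.
move=> M0 fM.
have m48 : (1 <= 48 / m)%R.
  by rewrite ler_pdivlMr// mul1r (le_trans m_le1)// ler1n.
have r0 : (0 < 48 / m * M)%R by rewrite mulr_gt0// (lt_le_trans ltr01).
rewrite -mulrA; apply: le_trans (small_scale_bound r0).
apply: le_measure; rewrite ?inE; [exact: mitv|exact: msmall|].
move=> t t01; have t01' : (0 <= t <= 1)%R by move: t01; rewrite /= in_itv.
split; first split => //=.
  by rewrite (le_trans (fM t t01'))// ler_peMl// ltW.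
move=> [a [b [gab _]]]; apply/negP; rewrite -leNgt -lee_fin.
have [_ _ ab _] := gab; have [a0 b1] := gap01 gab.
rewrite -(nu_gap gab (lexx a) (ltW ab) (lexx b)).
apply: le_trans (gap_low gab M0).
apply: le_measure; rewrite ?inE; [exact: mitv|exact: (measurableI _ _ (mitv _) (mlow _))|].
move=> x xab; split => //=; apply: fM.
move: xab; rewrite /= in_itv/= => /andP[ax xb].
by rewrite (le_trans a0 (ltW ax)) (le_trans xb b1).
Qed.

End length_from_shortcuts.

(** * The speed of a Lipschitz path *)

Lemma density_measure d (T : measurableType d) (R : realType)
    (mu : {measure set T -> \bar R}) (w : T -> \bar R) :
  measurable_fun setT w -> (forall x, 0 <= w x) ->
  exists nu : {measure set T -> \bar R}, forall A, nu A = \int[mu]_(x in A) w x.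
Proof.
move=> mw w0.
pose nu (A : set T) := \int[mu]_(x in A) w x.
have nu0 : nu set0 = 0 by exact: integral_set0.
have nu_ge0 A : 0 <= nu A by apply: integral_ge0.
have nuD : semi_sigma_additive nu by exact: semi_sigma_additive_nng_induced.
pose mix := isMeasure.Build _ _ _ nu nu0 nu_ge0 nuD.
pose nu' : {measure set T -> \bar R} := HB.pack nu mix.
by exists nu'.
Qed.

(** At a point of A that is a limit of points of A from the right, the difference
    quotients of g vanish along a sequence.  The other points of A are countably
    many: an interval of length 1/n.+1 contains at most one point of A that is
    followed by a hole of length 1/n.+1. *)
Lemma ae_derive_fiber_eq0 (R : realType) (V : normedModType R) (g : R -> V) (z : V) (A : set R) :
  (forall t, A t -> (0 <= t)%R) -> (forall t, A t -> g t = z) ->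
  {ae lebesgue_measure, forall t : R, A t -> derivable g t (1 : R)%R -> derive1 g t = 0%R}.
Proof.
move=> A0 Az.
pose J (n k : nat) := [set t : R | [/\ A t, forall s, A s -> (t < s)%R -> (t + n.+1%:R^-1 <= s)%R &
  (k%:R / n.+1%:R <= t < k.+1%:R / n.+1%:R)%R]].
have J1 n k : lebesgue_measure.-negligible (J n k).
  have [->|/set0P[t Jt]] := eqVneq (J n k) set0; first exact: negligible_set0.
  have N1 : lebesgue_measure.-negligible ([set t] : set (measurableTypeR R)).
    by apply/negligibleP => //; exact: lebesgue_measure_set1.
  have le_J x y : J n k x -> J n k y -> (y <= x)%R.
    move=> [Ax xs /andP[kx _]] [Ay _ /andP[_ yk]]; rewrite leNgt; apply/negP => xy.
    have := xs _ Ay xy; apply/negP; rewrite -ltNge (lt_le_trans yk)//.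
    by rewrite -natr1 mulrDl mul1r lerD2r.
  by apply: negligibleS N1 => s Js /=; apply/eqP; rewrite eq_le !le_J.
have NJ : lebesgue_measure.-negligible (\bigcup_n \bigcup_k J n k).
  by apply: negligible_bigcup => n; apply: negligible_bigcup => k; exact: J1.
apply: negligibleS NJ => t /= /not_implyP[At] /not_implyP[dg g't].
apply: contrapT => nJ; apply: g't.
have acc e : (0 < e)%R -> exists s, [/\ A s, (t < s)%R & (s < t + e)%R].
  move=> e0; apply: contrapT => nacc; apply: nJ.
  pose n := Num.bound e^-1; exists n => //; pose k := Num.truncn (t * n.+1%:R).
  have tn : (0 <= t * n.+1%:R)%R by rewrite mulr_ge0// A0.
  exists k => //; split => //; last first.
    rewrite ler_pdivrMr// ltr_pdivlMr//; exact: truncn_itv.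
  move=> s As ts; rewrite leNgt; apply/negP => sn; apply: nacc; exists s; split => //.
  apply: lt_trans sn _; rewrite ltrD2l -[ltRHS]invrK ltf_pV2 ?posrE ?invr_gt0//.
  apply: (@lt_trans _ _ n%:R); last by rewrite ltr_nat.
  by apply: archi_boundP; rewrite invr_ge0 ltW.
rewrite derive1E; apply/eqP; apply: contrapT => /negP L0.
have dgL : h^-1 *: ((g \o shift t) (h *: (1 : R)) - g t) @[h --> (0%R : R)^'] --> 'D_1 g t by exact: dg.
move: ('D_1 g t) L0 dgL => L L0.
have Lpos : (0 < `|L|)%R by rewrite normr_gt0.
move=> /cvgrPdist_lt/(_ _ Lpos)[e /= e0 He].
have [s [As ts ste]] := acc e e0.
have st0 : (s - t != 0)%R by rewrite subr_eq0 gt_eqF.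
have := He (s - t)%R; rewrite /ball_/= sub0r normrN gtr0_norm ?subr_gt0// ltrBlDl => /(_ ste st0).
have -> : ((s - t) *: (1 : R) = s - t)%R by exact: mulr1.
by rewrite subrK (Az _ As) (Az _ At) subrr scaler0 subr0 ltxx.
Qed.

Lemma minr_lip (R : realType) (s a b : R) :
  (`|Num.min a s - Num.min b s| <= `|a - b|)%R.
Proof.
have h1 := ler_norm (a - b)%R; have h2 := ler_norm (b - a)%R.
rewrite distrC in h2; rewrite ler_norml.
by case: (leP a s) => ?; case: (leP b s) => ?; lra.
Qed.

Lemma maxr_lip (R : realType) (s a b : R) :
  (`|Num.max a s - Num.max b s| <= `|a - b|)%R.
Proof.
have h1 := ler_norm (a - b)%R; have h2 := ler_norm (b - a)%R.
rewrite distrC in h2; rewrite ler_norml.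
by case: (leP a s) => ?; case: (leP b s) => ?; lra.
Qed.

Definition clamp (R : realType) (a b t : R) : R := Num.max (Num.min t b) a.

Lemma clamp_lip (R : realType) (a b s t : R) :
  (`|clamp a b s - clamp a b t| <= `|s - t|)%R.
Proof. exact: le_trans (maxr_lip _ _ _) (minr_lip _ _ _). Qed.

Lemma clamp_id (R : realType) (a b t : R) : (a <= t <= b)%R -> clamp a b t = t.
Proof. by move=> /andP[at_ tb]; rewrite /clamp min_l// max_l. Qed.

Lemma clamp_itv (R : realType) (a b t : R) : (a <= b)%R -> (a <= clamp a b t <= b)%R.
Proof. by move=> ab; rewrite /clamp le_max lexx orbT ge_max ge_min lexx orbT ab. Qed.

Lemma derivable_near_eq (R : realType) (V : normedModType R) (g h : R -> V) (t : R) :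
  {near t, g =1 h} -> derivable g t (1 : R)%R ->
  derivable h t (1 : R)%R /\ derive1 h t = derive1 g t.
Proof.
move=> gh dg; split; first exact: near_eq_derivable gh dg.
by rewrite !derive1E (near_eq_derive _ gh).
Qed.

Lemma near_itv (R : realType) (a b t : R) : (a < t < b)%R -> \forall u \near t, (a < u < b)%R.
Proof.
move=> /andP[at_ tb]; near=> u; apply/andP; split; near: u.
  exact: lt_nbhsr.
exact: lt_nbhsl.
Unshelve. all: by end_near. Qed.

Lemma ae_imply (R : realType) (P Q : R -> Prop) :
  (forall t, P t -> Q t) ->
  {ae (@lebesgue_measure R), forall t : R, P t} -> {ae (@lebesgue_measure R), forall t : R, Q t}.
Proof. exact: (@filterS _ _ (ae_filter_ringOfSetsType (@lebesgue_measure R)) P Q). Qed.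

Lemma ae_imply2 (R : realType) (P Q S : R -> Prop) :
  (forall t, P t -> Q t -> S t) ->
  {ae (@lebesgue_measure R), forall t : R, P t} -> {ae (@lebesgue_measure R), forall t : R, Q t} ->
  {ae (@lebesgue_measure R), forall t : R, S t}.
Proof. exact: (@filterS2 _ _ (ae_filter_ringOfSetsType (@lebesgue_measure R)) P Q S). Qed.

Lemma ae_itv_oo (R : realType) (P : R -> Prop) (a b : R) :
  {ae lebesgue_measure, forall t : R, (a < t < b)%R -> P t} ->
  {ae lebesgue_measure, forall t : R, `[a, b]%classic t -> (a < t < b)%R /\ P t}.
Proof.
move=> aeP.
have N (c : R) : lebesgue_measure.-negligible ([set c] : set (measurableTypeR R)).
  by apply/negligibleP => //; exact: lebesgue_measure_set1.
apply: negligibleS (negligibleU aeP (negligibleU (N a) (N b))).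
move=> t /= /not_implyP[]; rewrite in_itv/= => /andP[at_ tb] nP.
have [ta|ta] := eqVneq t a; first by right; left.
have [tb'|tb'] := eqVneq t b; first by right; right.
have tab : (a < t < b)%R by rewrite !lt_neqAle at_ tb (eq_sym a) ta tb'.
left => /(_ tab) Pt; exact: nP.
Qed.

(** Here g is the given path and G extends its restriction to [0, 1] to a
    globally Lipschitz curve with derivative psi. *)
Section speed.
Context (R : realType) (d : nat) (g G psi : R -> 'rV[R]_d) (K : R).
Notation leb := (@lebesgue_measure R).
Hypothesis GK : forall s t, (enorm (G s - G t) <= K * `|s - t|)%R.
Hypothesis gG : forall t, (0 <= t <= 1)%R -> g t = G t.
Hypothesis psi_meas : forall i, measurable_fun setT (fun t => psi t ord0 i).
Hypothesis psi_int : forall i, leb.-integrable `[0%R, 1%R] (fun t => (psi t ord0 i)%:E).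
Hypothesis psi_inc : forall i s t, (0 <= s)%R -> (s <= t)%R -> (t <= 1)%R ->
  (G t ord0 i - G s ord0 i)%:E = \int[leb]_(x in `]s, t]) (psi x ord0 i)%:E.
Hypothesis psi_der : {ae leb, forall t : R, (0 < t < 1)%R ->
  derivable G t (1 : R)%R /\ derive1 G t = psi t}.

Let W t := enorm (psi t).

Lemma measurable_speed : measurable_fun setT W.
Proof.
apply: measurableT_comp.
  exact: (continuous_measurable_fun (@sqrt_continuous R)).
apply: measurable_sum => i; apply: measurable_funX; exact: psi_meas.
Qed.

Lemma integrable_speed : leb.-integrable `[0%R, 1%R] (EFin \o W).
Proof.
have mI : measurable (`[0%R, 1%R]%classic : set (measurableTypeR R)) by exact: measurable_itv.
apply: (le_integrable mI (g := fun t => \sum_(i < d) `|(psi t ord0 i)%:E|)).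
- by apply/measurable_EFinP; exact: measurable_funTS measurable_speed.
- move=> t _ /=; rewrite [leRHS]gee0_abs ?sume_ge0//.
  rewrite ger0_norm ?enorm_ge0// sumEFin lee_fin; exact: enorm_le_sum.
- apply: integrable_sum => // i _; exact: integrable_abse.
Qed.

Lemma curve_ae : {ae leb, forall t : R, `[0%R, 1%R]%classic t ->
  (0 < t < 1)%R /\ (derivable g t (1 : R)%R /\ derive1 g t = psi t)}.
Proof.
apply: ae_itv_oo; apply: ae_imply psi_der => t Gt t01.
have [dG <-] := Gt t01; apply: derivable_near_eq => //.
apply: filterS (near_itv t01) => u /andP[u0 u1].
by rewrite gG// !ltW.
Qed.

Lemma path_length_speed : path_length g = \int[leb]_(t in `[0%R, 1%R]) (W t)%:E.
Proof.
apply: ae_ge0_eq_lower_integral.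
- exact: measurable_itv.
- by move=> t _; rewrite lee_fin enorm_ge0.
- by move=> t _; rewrite lee_fin enorm_ge0.
by apply: ae_imply curve_ae => t h /h [_ [_ ->]].
Qed.

Let integrable_speed_sub (A : set (measurableTypeR R)) : measurable A -> A `<=` `[0%R, 1%R] ->
  leb.-integrable A (EFin \o W).
Proof.
move=> mA A01; apply: integrableS integrable_speed => //; exact: measurable_itv.
Qed.

(** Almost everywhere psi is the speed times the fixed direction v, so the
    increment of G is the length times v. *)
Lemma straight_increment (v : 'rV[R]_d) (a b s t : R) : enorm v = 1%R ->
  (0 <= a)%R -> (b <= 1)%R ->
  (forall u, (a < u < b)%R -> derivable g u (1 : R)%R ->
    derive1 g u = (enorm (derive1 g u) *: v)%R) ->
  (a <= s)%R -> (s <= t)%R -> (t <= b)%R ->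
  \int[leb]_(u in `]s, t]) (W u)%:E = (enorm (G t - G s))%:E.
Proof.
move=> v1 a0 b1 gv as_ st tb.
have mst : measurable (`]s, t]%classic : set (measurableTypeR R)) by exact: measurable_itv.
have st01 : `]s, t]%classic `<=` `[0%R, 1%R]%classic.
  move=> u; rewrite /= !in_itv/= => /andP[su ut].
  by rewrite (le_trans a0 (le_trans as_ (ltW su))) (le_trans ut (le_trans tb b1)).
have iW := integrable_speed_sub mst st01.
have Wfin := integrable_fin_num mst iW.
pose w := fine (\int[leb]_(u in `]s, t]) (W u)%:E).
have wE : \int[leb]_(u in `]s, t]) (W u)%:E = w%:E by rewrite fineK.
have w0 : (0 <= w)%R.
  by rewrite -lee_fin -wE; apply: integral_ge0 => u _; rewrite lee_fin enorm_ge0.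
have aeWv i : {ae leb, forall u : R, `]s, t]%classic u -> (psi u ord0 i)%:E = (v ord0 i)%:E * (W u)%:E}.
  have aeab : {ae leb, forall u : R, `[a, b]%classic u -> (a < u < b)%R /\ True}.
    by apply: ae_itv_oo; apply: aeW.
  apply: ae_imply2 curve_ae aeab => u h k ust.
  have [_ [dg <-]] := h (st01 _ ust).
  have [|uab _] := k.
    move: ust; rewrite /= !in_itv/= => /andP[su ut].
    by rewrite (le_trans as_ (ltW su)) (le_trans ut tb).
  rewrite /W; have [_ [_ <-]] := h (st01 _ ust).
  by rewrite {1}(gv _ uab dg) mxE mulrC.
have GE : (G t - G s = w *: v)%R.
  apply/rowP => i; rewrite !mxE; apply: EFin_inj.
  rewrite psi_inc ?(le_trans a0 as_) ?(le_trans tb b1)//.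
  rewrite mulrC EFinM -wE -(integralZl mst iW).
  apply: ae_eq_integral => //.
  - by apply/measurable_EFinP; exact: measurable_funTS (psi_meas i).
  - by apply: emeasurable_funM => //; exact: (measurable_int _ iW).
  - exact: aeWv.
by rewrite GE enormZ v1 mulr1 ger0_norm// wE.
Qed.

Lemma integral_speed_fiber z :
  \int[leb]_(t in `[0%R, 1%R]%classic `&` [set t | G t = z]) (W t)%:E = 0.
Proof.
have mA : measurable (`[0%R, 1%R]%classic `&` [set t | G t = z] : set (measurableTypeR R)).
  apply: measurableI; first exact: measurable_itv.
  by apply: closed_measurable; exact: closed_curve_fiber GK.
rewrite (@ae_ge0_eq_lower_integral _ _ _ _ _ _ (cst 0)) ?integral0//.
  by move=> t _; rewrite lee_fin enorm_ge0.
have := @ae_derive_fiber_eq0 R _ g z (`[0%R, 1%R]%classic `&` [set t | G t = z]) _ _.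
case/(_ _ _)/Wrap => [t [/= + _]|t [/= t01 <-]|].
- by rewrite in_itv => /andP[].
- by rewrite gG//; move: t01; rewrite in_itv.
apply: ae_imply2 curve_ae => t h k tA; have [t01 _] := tA.
have [_ [dg g't]] := h t01.
by rewrite /W -g't (k tA dg) enorm0.
Qed.

End speed.

(** * Shortcuts *)

Section shortcut_path.
Context (R : realType) (d : nat) (G : R -> 'rV[R]_d) (K s t : R).
Hypothesis GK : forall s t, (enorm (G s - G t) <= K * `|s - t|)%R.
Hypothesis st : (s < t)%R.

(** Writing the path that follows the segment from G s to G t during [s, t] as a
    sum of three Lipschitz terms, each constant outside one of the three
    intervals cut by s and t, gives its Lipschitz bound without case
    distinctions. *)
Definition shortcut_path (u : R) : 'rV[R]_d :=
  (G (Num.min u s) + ((clamp s t u - s) / (t - s)) *: (G t - G s) +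
    (G (Num.max u t) - G t))%R.

Lemma shortcut_path_left u : (u <= s)%R -> shortcut_path u = G u.
Proof.
move=> us; have ut := le_trans us (ltW st).
rewrite /shortcut_path /clamp (min_l us) (min_l ut) (max_r us) (max_r ut).
by rewrite subrr mul0r scale0r subrr !addr0.
Qed.

Lemma shortcut_path_right u : (t <= u)%R -> shortcut_path u = G u.
Proof.
move=> tu; have su := le_trans (ltW st) tu.
rewrite /shortcut_path /clamp (min_r su) (min_r tu) (max_l (ltW st)) (max_l tu).
by rewrite divff ?subr_eq0 ?gt_eqF// scale1r addrC subrKC subrK.
Qed.

Lemma shortcut_path_mid u : (s <= u <= t)%R ->
  shortcut_path u = (G s + ((u - s) / (t - s)) *: (G t - G s))%R.
Proof.
move=> sut; have /andP[su ut] := sut.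
by rewrite /shortcut_path (clamp_id sut) (min_r su) (max_r ut) subrr addr0.
Qed.

Lemma shortcut_path_lip u v :
  (enorm (shortcut_path u - shortcut_path v) <= (3 * `|K|) * `|u - v|)%R.
Proof.
have K0 (a b c e : R) : (`|a - b| <= `|c - e| -> enorm (G a - G b) <= `|K| * `|c - e|)%R.
  move=> h; apply: le_trans (GK a b) _.
  apply: (@le_trans _ _ (`|K| * `|a - b|)%R); first by rewrite ler_wpM2r// ler_norm.
  exact: ler_wpM2l.
have ts0 : (0 < t - s)%R by rewrite subr_gt0.
rewrite /shortcut_path.
rewrite [X in enorm X](_ : _ = (G (Num.min u s) - G (Num.min v s)) +
  (((clamp s t u - clamp s t v) / (t - s)) *: (G t - G s)) +
  (G (Num.max u t) - G (Num.max v t)))%R; last first.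
  have -> : ((clamp s t u - clamp s t v) / (t - s) =
     (clamp s t u - s) / (t - s) - (clamp s t v - s) / (t - s))%R.
    by rewrite -mulrBl opprB addrA subrK.
  by rewrite scalerBl; apply/rowP => i; rewrite !mxE; ring.
apply: le_trans (ler_enormD _ _) _.
have -> : (3 * `|K| * `|u - v| = (`|K| * `|u - v| + `|K| * `|u - v|) + `|K| * `|u - v|)%R by ring.
apply: lerD; last by apply: K0; exact: maxr_lip.
apply: le_trans (ler_enormD _ _) _; apply: lerD; first by apply: K0; exact: minr_lip.
rewrite enormZ normrM normrV ?unitfE ?gt_eqF// (gtr0_norm ts0).
have := K0 t s t s (lexx _); rewrite (gtr0_norm ts0) => GKts.
rewrite mulrAC ler_pdivrMr//.
apply: (@le_trans _ _ (`|u - v| * (`|K| * (t - s)))%R).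
  by apply: ler_pM; rewrite ?enorm_ge0 ?normr_ge0// clamp_lip.
by rewrite mulrCA mulrA.
Qed.

Lemma shortcut_path_derive u : (s < u < t)%R ->
  derivable shortcut_path u (1 : R)%R /\
  derive1 shortcut_path u = ((t - s)^-1 *: (G t - G s))%R.
Proof.
move=> sut.
pose w := (G t - G s)%R; pose k := ((t - s)^-1)%R.
pose f := fun x : R => (G s + ((x - s) / (t - s)) *: w)%R.
have df : is_derive u (1 : R)%R f (k *: w)%R.
  have q : h^-1 *: ((f \o shift u) (h *: (1 : R)) - f u) @[h --> (0%R : R)^'] --> (k *: w)%R.
    apply: cvg_trans (near_eq_cvg _) (cvg_cst (k *: w)%R).
    near=> h; have h0 : (h != 0)%R by near: h; exact: nbhs_dnbhs_neq.
    have h1 : (h *: (1 : R) = h)%R by exact: mulr1.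
    rewrite /f /= h1 opprD addrACA subrr add0r -scalerBl -mulrBl.
    rewrite scalerA; congr (_ *: _)%R.
    by rewrite -/k opprB addrA subrK addrK mulrA mulVf// mul1r.
  by apply: DeriveDef; [apply/cvg_ex; exists (k *: w)%R|exact: cvg_lim q].
have fE : {near u, f =1 shortcut_path}.
  apply: filterS (near_itv sut) => x /andP[sx xt].
  by rewrite shortcut_path_mid// !ltW.
have [ds' ->] := derivable_near_eq fE (@ex_derive _ _ _ _ _ _ _ df).
split=> //; by rewrite derive1E derive_val.
Unshelve. all: by end_near. Qed.

End shortcut_path.

Definition stops (R : realType) (d : nat) (F : set 'rV[R]_d) (G : R -> 'rV[R]_d) : set R :=
  [set t | (0 <= t <= 1)%R /\ (F (G t) \/ t = 0%R \/ t = 1%R)].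

(** A time interval on which the new path avoids F contains neither s nor t, which
    are stops of the new path too; so it lies in [s, t], where the new path is a
    segment, or on one side, where the new path is the old one.  The vector v0
    serves as direction when the segment is reduced to a point. *)
Lemma shortcut_admissible (R : realType) (d : nat) (F : set 'rV[R]_d) (x y v0 : 'rV[R]_d)
    (g G : R -> 'rV[R]_d) (K s t : R) :
  (forall s t, enorm (G s - G t) <= K * `|s - t|)%R ->
  (forall t, (0 <= t <= 1)%R -> g t = G t) -> enorm v0 = 1%R ->
  stops F G s -> stops F G t -> (s < t)%R ->
  admissible F x y g -> admissible F x y (shortcut_path G s t).
Proof.
move=> GK gG v01 [s01 Fs] [t01 Ft] st [_ g0 g1 gF].
have /andP[s0 s1] := s01; have /andP[t0 t1] := t01.
have hs : shortcut_path G s t s = G s by rewrite shortcut_path_left.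
have ht : shortcut_path G s t t = G t by rewrite shortcut_path_right.
split.
- by exists (3 * `|K|)%R => a b _ _; exact: shortcut_path_lip.
- rewrite -g0 gG ?lexx ?ler01//.
  by rewrite shortcut_path_left.
- rewrite -g1 gG ?lexx ?ler01//.
  by rewrite shortcut_path_right.
move=> a b a0 ab b1 hF.
have stop_notin w : (0 <= w <= 1)%R -> (F (G w) \/ w = 0%R \/ w = 1%R) ->
    shortcut_path G s t w = G w -> (w <= a)%R \/ (b <= w)%R.
  move=> _ Fw hw; have [|aw] := leP w a; first by left.
  have [|wb] := leP b w; first by right.
  have := hF w; rewrite in_itv/= aw wb hw => /(_ isT) nF.
  case: Fw => [//|[w0|w1]].
    by move: aw; rewrite w0 ltNge a0.
  by move: wb; rewrite w1 ltNge b1.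
have outer : (b <= s)%R \/ (t <= a)%R -> exists2 v : 'rV[R]_d, enorm v = 1%R &
    forall u, u \in `]a, b[ -> derivable (shortcut_path G s t) u 1%R ->
      derive1 (shortcut_path G s t) u = (enorm (derive1 (shortcut_path G s t) u) *: v)%R.
  move=> out.
  have hg u : (a < u < b)%R -> g u = shortcut_path G s t u.
    move=> /andP[au ub]; rewrite gG ?(le_trans a0 (ltW au)) ?(le_trans (ltW ub) b1)//.
    case: out => [bs|ta].
      by rewrite shortcut_path_left// (le_trans (ltW ub)).
    by rewrite shortcut_path_right// (le_trans ta (ltW au)).
  have [|v v1 gv] := gF a b a0 ab b1.
    by move=> u uab; rewrite hg; [exact: hF|move: uab; rewrite in_itv].
  exists v; first exact: v1.
  move=> u uab dh.
  have uab' : (a < u < b)%R by move: uab; rewrite in_itv.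
  have hgn : {near u, shortcut_path G s t =1 g}.
    by apply: filterS (near_itv uab') => w /hg ->.
  have [dg <-] := derivable_near_eq hgn dh.
  exact: gv.
have [sa|bs] := stop_notin s s01 Fs hs; last by apply: outer; left.
have [ta|bt] := stop_notin t t01 Ft ht; first by apply: outer; right.
have dE u : u \in `]a, b[ -> derive1 (shortcut_path G s t) u = ((t - s)^-1 *: (G t - G s))%R.
  rewrite in_itv/= => /andP[au ub].
  have sut : (s < u < t)%R by rewrite (le_lt_trans sa au) (lt_le_trans ub bt).
  by have [_ ->] := shortcut_path_derive G sut.
have [Gst|nGst] := eqVneq (enorm (G t - G s)) 0%R.
  exists v0; first exact: v01.
  move=> u uab _; rewrite (dE _ uab) (enorm_eq0 Gst).
  by rewrite !scaler0 enorm0 scale0r.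
exists ((enorm (G t - G s))^-1 *: (G t - G s))%R.
  by rewrite enormZ ger0_norm ?invr_ge0 ?enorm_ge0// mulVf.
move=> u uab _; rewrite (dE _ uab) enormZ ger0_norm ?invr_ge0 ?subr_ge0 ?(ltW st)//.
by rewrite scalerA mulfK.
Qed.

Section geodesic.
Context (R : realType) (d : nat) (mu : probability (borelRd R d) R) (m p beta : R).
Hypotheses (m_gt0 : (0 < m)%R) (m_le1 : (m <= 1)%R) (p_ge1 : (1 <= p)%R) (beta_ge1 : (1 <= beta)%R).
Variable D : 'rV[R]_d -> R.
Hypothesis DE : forall z, dtm m p mu z = (D z)%:E.
Variables (F : set 'rV[R]_d) (x y v0 : 'rV[R]_d) (g G psi : R -> 'rV[R]_d) (K : R).
Notation leb := (@lebesgue_measure R).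
Hypothesis v01 : enorm v0 = 1%R.
Hypothesis GK : forall s t, (enorm (G s - G t) <= K * `|s - t|)%R.
Hypothesis gG : forall t, (0 <= t <= 1)%R -> g t = G t.
Hypothesis psi_meas : forall i, measurable_fun setT (fun t => psi t ord0 i).
Hypothesis psi_int : forall i, leb.-integrable `[0%R, 1%R] (fun t => (psi t ord0 i)%:E).
Hypothesis psi_der : {ae leb, forall t : R, (0 < t < 1)%R ->
  derivable G t (1 : R)%R /\ derive1 G t = psi t}.
Hypothesis geo : geodesic m p beta mu F x y g.

Let W t := enorm (psi t).
Let f t := D (G t).
Let phi t := (f t `^ beta * W t)%R.

Let beta_gt0 : (0 < beta)%R. Proof. exact: lt_le_trans beta_ge1. Qed.
Let D_ge0 z : (0 <= D z)%R. Proof. by rewrite -lee_fin -DE dtm_ge0. Qed.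
Let phi_ge0 t : (0 <= phi t)%R. Proof. by rewrite mulr_ge0 ?powR_ge0 ?enorm_ge0. Qed.
Let mI : measurable (`[0%R, 1%R]%classic : set (measurableTypeR R)).
Proof. exact: measurable_itv. Qed.

Let mf : measurable_fun setT f.
Proof.
apply: continuous_measurable_fun; apply: (lipschitz_continuous (L := K)) => s t.
exact: (dtm_curve_lip m_gt0 m_le1 p_ge1 DE GK).
Qed.

Let mphi : measurable_fun setT phi.
Proof.
apply: measurable_funM; last exact: measurable_speed.
exact: (@measurableT_comp _ _ _ _ _ _ (@powR R ^~ beta)).
Qed.

Lemma fdtm_length_speed : fdtm_length m p beta mu g = \int[leb]_(t in `[0%R, 1%R]) (phi t)%:E.
Proof.
apply: ae_ge0_eq_lower_integral => //.
- by move=> t _; rewrite mule_ge0 ?poweR_ge0// lee_fin enorm_ge0.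
- by move=> t _; rewrite lee_fin phi_ge0.
apply: ae_imply (curve_ae gG psi_der) => t h t01.
have [_ [_ ->]] := h t01.
by rewrite gG ?DE//; move: t01; rewrite /= in_itv.
Qed.

Let integrable_phi : leb.-integrable `[0%R, 1%R] (EFin \o phi).
Proof.
pose B := (f 0 + `|K|)%R.
have B0 : (0 <= B)%R by rewrite addr_ge0 ?D_ge0.
have iW := integrableZl mI (B `^ beta)%R (integrable_speed psi_meas psi_int).
apply: (le_integrable mI _ _ iW); first by apply/measurable_EFinP; exact: measurable_funTS.
move=> t; rewrite /= in_itv/= => /andP[t0 t1].
rewrite lee_fin !ger0_norm ?phi_ge0 ?mulr_ge0 ?powR_ge0 ?enorm_ge0//.
rewrite ler_wpM2r ?enorm_ge0// ge0_ler_powR ?nnegrE ?D_ge0 ?(ltW beta_gt0)//.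
have := dtm_curve_lip m_gt0 m_le1 p_ge1 DE GK t 0%R.
rewrite subr0 (ger0_norm t0) => h; have := le_trans (ler_norm _) h.
have : (K * t <= `|K|)%R.
  by apply: le_trans (ler_norm _) _; rewrite normrM (ger0_norm t0) ler_piMr.
by rewrite /B /f; lra.
Qed.

(** The shortcut has the same energy as the geodesic outside [s, t] and energy at
    most |G t - G s| C^beta inside, so minimality bounds the energy of the
    geodesic inside; and where f > c the energy is at least c^beta times the
    length. *)
Lemma geodesic_shortcut (s t C c : R) : stops F G s -> stops F G t -> (s < t)%R -> (0 < c)%R ->
  (forall th, (0 <= th <= 1)%R -> (D (G s + th *: (G t - G s)) <= C)%R) ->
  (c `^ beta)%:E * \int[leb]_(u in `]s, t]%classic `&` [set u | (c < f u)%R]) (W u)%:E <=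
  (enorm (G t - G s) * C `^ beta)%:E.
Proof.
move=> Ts Tt st c0 DC.
have [adm gE] := geo.
have [/andP[s0 s1] _] := Ts; have [/andP[t0 t1] _] := Tt.
pose A : set (measurableTypeR R) := `]s, t]%classic.
have mA : measurable A by exact: measurable_itv.
have mAC : measurable (~` A) by exact: measurableC.
have AI : A `<=` `[0%R, 1%R]%classic.
  move=> u; rewrite /A /= !in_itv/= => /andP[su ut].
  by rewrite (le_trans s0 (ltW su)) (le_trans ut t1).
pose l := enorm (G t - G s).
pose k := (C `^ beta * (l / (t - s)))%R.
have ts0 : (0 < t - s)%R by rewrite subr_gt0.
have C0 : (0 <= C)%R by apply: le_trans (DC 0%R _); rewrite ?D_ge0 ?lexx ?ler01.
have k0 : (0 <= k)%R by rewrite mulr_ge0 ?powR_ge0// divr_ge0 ?enorm_ge0// ltW.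
pose phiA : R -> \bar R := (EFin \o phi) \_ A.
pose phiAC : R -> \bar R := (EFin \o phi) \_ (~` A).
pose kA : R -> \bar R := (cst k%:E) \_ A.
have mEphi : measurable_fun setT (EFin \o phi) by exact/measurable_EFinP.
have mphiA : measurable_fun setT phiA.
  by apply/(measurable_restrictT _ mA); exact: measurable_funTS.
have mphiAC : measurable_fun setT phiAC.
  by apply/(measurable_restrictT _ mAC); exact: measurable_funTS.
have mkA : measurable_fun setT kA by apply/(measurable_restrictT _ mA).
have phiA0 u : 0 <= phiA u by rewrite /phiA patchE; case: ifPn => // _; rewrite lee_fin phi_ge0.
have phiAC0 u : 0 <= phiAC u by rewrite /phiAC patchE; case: ifPn => // _; rewrite lee_fin phi_ge0.
have kA0 u : 0 <= kA u by rewrite /kA patchE; case: ifPn => // _; rewrite lee_fin.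
have AE u : u \in A = (s < u <= t)%R.
  by apply/idP/idP; rewrite ?inE /A /= in_itv.
have ACE u : u \in ~` A = ~~ (s < u <= t)%R by rewrite in_setC AE.
have phiE u : (phi u)%:E = phiA u + phiAC u.
  rewrite /phiA /phiAC !patchE AE ACE; by case: ifPn => _; rewrite /= ?adde0 ?add0e.
(* Replacing phi by the constant k on ]s, t] gives an upper bound for the energy
   density of the shortcut. *)
have compare : \int[leb]_(u in `[0%R, 1%R]) (phi u)%:E <= \int[leb]_(u in `[0%R, 1%R]) (kA u + phiAC u).
  rewrite -fdtm_length_speed gE.
  apply: (@le_trans _ _ (fdtm_length m p beta mu (shortcut_path G s t))).
    by apply: ereal_inf_lbound; exists (shortcut_path G s t) => //; exact: shortcut_admissible GK gG v01 Ts Tt st adm.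
  apply: ae_ge0_le_lower_integral => //.
  - by move=> u _; rewrite mule_ge0 ?poweR_ge0// lee_fin enorm_ge0.
  - by move=> u _; rewrite adde_ge0.
  have aes : {ae leb, forall u : R, `[0%R, s]%classic u -> (0 < u < s)%R /\ True}.
    by apply: ae_itv_oo; apply: aeW.
  have aet : {ae leb, forall u : R, `[s, t]%classic u -> (s < u < t)%R /\ True}.
    by apply: ae_itv_oo; apply: aeW.
  apply: ae_imply2 (curve_ae gG psi_der) (ae_imply2 (fun u => @conj _ _) aes aet).
  move=> u h [hs ht] uI.
  have [u01 [dg g'u]] := h uI; have /andP[u0 u1] := u01.
  rewrite /kA /phiAC !patchE AE ACE.
  have same : {near u, g =1 shortcut_path G s t} ->
      dtm m p mu (shortcut_path G s t u) `^ beta * (enorm (derive1 (shortcut_path G s t) u))%:E = (phi u)%:E.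
    move=> near_gh; have [_ ->] := derivable_near_eq near_gh dg.
    rewrite g'u -(nbhs_singleton near_gh) gG ?(ltW u0) ?(ltW u1)//.
    by rewrite DE.
  case: ifPn => [/andP[su ut]|nsut].
    have [|sut _] := ht; first by rewrite /= in_itv/= (ltW su).
    have [_ ->] := shortcut_path_derive G sut.
    rewrite /= adde0 shortcut_path_mid ?(ltW su)// DE -EFinM lee_fin.
    rewrite enormZ ger0_norm ?invr_ge0 ?(ltW ts0)// /k -/l (mulrC l).
    apply: ler_wpM2r; first by rewrite mulr_ge0 ?enorm_ge0 ?invr_ge0 ?(ltW ts0).
    rewrite ge0_ler_powR ?nnegrE ?D_ge0 ?(ltW beta_gt0)//.
    apply: DC; rewrite divr_ge0 ?subr_ge0 ?(ltW su) ?(ltW st)//=.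
    by rewrite ler_pdivrMr// mul1r lerD2r.
  rewrite /= add0e same//.
  have [us|su] := leP u s.
    have [|/andP[_ us'] _] := hs; first by rewrite /= in_itv/= (ltW u0).
    apply: filterS (near_itv (introT andP (conj u0 us'))) => w /andP[w0 ws].
    by rewrite shortcut_path_left ?(ltW ws)// gG// (ltW w0) (le_trans (ltW ws)).
  have tu : (t < u)%R by rewrite ltNge; apply: contra nsut => ->; rewrite su.
  apply: filterS (near_itv (introT andP (conj tu u1))) => w /andP[tw w1].
  by rewrite shortcut_path_right ?(ltW tw)// gG// (ltW w1) (le_trans t0 (ltW tw)).
have phiI := integrable_fin_num mI integrable_phi.
have mI_ (h : R -> \bar R) : measurable_fun setT h ->
    measurable_fun (`[0%R, 1%R]%classic : set (measurableTypeR R)) h.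
  by move=> mh; exact: measurable_funTS.
have splitL : \int[leb]_(u in `[0%R, 1%R]) (phi u)%:E =
    \int[leb]_(u in `[0%R, 1%R]) phiA u + \int[leb]_(u in `[0%R, 1%R]) phiAC u.
  rewrite -ge0_integralD//; [|exact: mI_|exact: mI_].
  by apply: eq_integral => u _; rewrite phiE.
have splitR : \int[leb]_(u in `[0%R, 1%R]) (kA u + phiAC u) =
    \int[leb]_(u in `[0%R, 1%R]) kA u + \int[leb]_(u in `[0%R, 1%R]) phiAC u.
  by rewrite ge0_integralD//; exact: mI_.
have phiAC_fin : \int[leb]_(u in `[0%R, 1%R]) phiAC u \is a fin_num.
  rewrite ge0_fin_numE ?integral_ge0//.
  apply: (@le_lt_trans _ _ (\int[leb]_(u in `[0%R, 1%R]) (phi u)%:E)).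
    by rewrite splitL leeDr// integral_ge0.
  by move: phiI; rewrite ge0_fin_numE// integral_ge0// => u _; rewrite lee_fin phi_ge0.
have AIE : `[0%R, 1%R]%classic `&` A = A by rewrite setIC; exact: setIidl.
have phiA_le : \int[leb]_(u in A) (phi u)%:E <= (l * C `^ beta)%:E.
  move: compare; rewrite splitL splitR leeD2rE//.
  rewrite /phiA /kA -!integral_mkcondr AIE => /le_trans; apply.
  rewrite integral_cst//= lebesgue_measure_itv/= lte_fin st -EFinB -EFinM lee_fin.
  by rewrite /k -mulrA divfK ?gt_eqF// mulrC.
apply: le_trans phiA_le.
have mB : measurable (A `&` [set u | (c < f u)%R] : set (measurableTypeR R)).
  apply: measurableI => //.
  rewrite (_ : [set u | _] = f @^-1` `]c, +oo[%classic).
    by rewrite -[X in measurable X]setTI; apply: mf => //; exact: measurable_itv.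
  by apply/seteqP; split => u; rewrite /= in_itv/= andbT.
have BI : A `&` [set u | (c < f u)%R] `<=` `[0%R, 1%R]%classic by move=> u [/AI].
have mW : measurable_fun setT W by exact: measurable_speed.
have mEW (B : set (measurableTypeR R)) : measurable B -> measurable_fun B (EFin \o W).
  by move=> mB'; apply: measurable_funTS; exact/measurable_EFinP.
rewrite -ge0_integralZl//; last 3 first.
- exact: mEW.
- by move=> u _; rewrite lee_fin enorm_ge0.
- by rewrite lee_fin powR_ge0.
apply: (@le_trans _ _ (\int[leb]_(u in A `&` [set u | (c < f u)%R]) (phi u)%:E)).
  apply: ge0_le_integral => //.
  - by move=> u _; rewrite mule_ge0// lee_fin ?powR_ge0// enorm_ge0.
  - by apply: emeasurable_funM => //; exact: mEW.
  - exact: measurable_funTS.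
  - move=> u [_ /= cu]; rewrite -EFinM lee_fin ler_wpM2r ?enorm_ge0//.
    by rewrite ge0_ler_powR ?nnegrE ?(ltW c0) ?(ltW beta_gt0) ?D_ge0// ltW.
apply: ge0_subset_integral => //.
- exact: measurable_funTS.
- by move=> u _; rewrite lee_fin phi_ge0.
Qed.

End geodesic.

(** * The length bound *)

Lemma closed_stops (R : realType) (d : nat) (F : set 'rV[R]_d) (G : R -> 'rV[R]_d) (K : R) :
  (forall s t, enorm (G s - G t) <= K * `|s - t|)%R -> closed F ->
  closed (stops F G).
Proof.
move=> GK cF.
have cG : continuous G.
  apply: (lipschitz_continuous (L := K)) => s t.
  exact: le_trans (norm_le_enorm _) (GK s t).
have -> : stops F G = `[0%R, 1%R]%classic `&` (G @^-1` F `|` [set 0%R; 1%R]).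
  by apply/seteqP; split => t; rewrite /stops /= in_itv/=; tauto.
apply: closedI; first exact: interval_closed.
apply: closedU; first by apply: closed_comp => // t _; exact: cG.
by apply: closedU; exact: closed_eq.
Qed.

Lemma unit_vector_exists (R : realType) (d : nat) : exists v : 'rV[R]_d.+1, enorm v = 1%R.
Proof.
exists (delta_mx ord0 ord0); rewrite /enorm (bigD1 ord0)//= big1 => [|i i0].
  by rewrite mxE !eqxx expr1n addr0 sqrtr1.
by rewrite mxE (negbTE i0) expr0n.
Qed.

Lemma geodesic_length_le (R : realType) (d : nat) (mu : probability (borelRd R d) R)
    (m p beta : R) (F : set 'rV[R]_d) (x y : 'rV[R]_d) (g : R -> 'rV[R]_d) (M : R) :
  (0 < m)%R -> (m <= 1)%R -> (1 <= p)%R -> (1 <= beta)%R ->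
  (forall z, dtm m p mu z \is a fin_num) -> closed F -> (exists v : 'rV[R]_d, enorm v = 1%R) ->
  geodesic m p beta mu F x y g -> (0 < M)%R ->
  (forall t, (0 <= t <= 1)%R -> dtm m p mu (g t) <= M%:E) ->
  path_length g <= (2 * scale_cst m beta * (48 / m) * M)%:E.
Proof.
move=> m0 m1 p1 beta1 dfin cF [v0 v01] geo M0 gM.
have [[[K0 gK0] g0 g1 gF] _] := geo.
pose G (t : R) := g (clamp 0 1 t).
have c01 (t : R) : clamp 0 1 t \in `[0%R, 1%R] by rewrite in_itv/= clamp_itv.
have gG (t : R) : (0 <= t <= 1)%R -> g t = G t by move=> t01; rewrite /G clamp_id.
pose K := `|K0|%R.
have GK (s t : R) : (enorm (G s - G t) <= K * `|s - t|)%R.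
  apply: le_trans (gK0 _ _ (c01 s) (c01 t)) _.
  apply: (@le_trans _ _ (K * `|clamp 0 1 s - clamp 0 1 t|)%R).
    by rewrite ler_wpM2r// ler_norm.
  by apply: ler_wpM2l; [exact: normr_ge0|exact: clamp_lip].
have [psi [psi_meas psi_int psi_inc psi_der]] := lipschitz_density GK.
pose D z := fine (dtm m p mu z).
have DE z : dtm m p mu z = (D z)%:E by rewrite fineK.
pose I : set (measurableTypeR R) := `[0%R, 1%R]%classic.
have mI : measurable I by exact: measurable_itv.
pose W t := enorm (psi t).
have mW : measurable_fun setT W by exact: measurable_speed.
pose w : measurableTypeR R -> \bar R := (EFin \o W) \_ I.
have mw : measurable_fun setT w.
  by apply/(measurable_restrictT _ mI); apply: measurable_funTS; exact/measurable_EFinP.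
have w0 t : 0 <= w t by rewrite /w patchE; case: ifPn => // _; rewrite lee_fin enorm_ge0.
have [nu nuE] := density_measure (@lebesgue_measure R) mw w0.
have nuI (A : set (measurableTypeR R)) : A `<=` I ->
    nu A = \int[lebesgue_measure]_(t in A) (W t)%:E.
  move=> AI; rewrite nuE; apply: eq_integral => t /set_mem /AI It.
  by rewrite /w patchE mem_set.
have nuII : nu I = path_length g by rewrite nuI// (path_length_speed gG psi_der).
rewrite -nuII.
have T01 : stops F G `<=` I by move=> t [t01 _]; rewrite /I /= in_itv.
apply: (length_le_max m0 m1 p1 DE GK (closed_stops GK cF) T01) => //.
- by split; [rewrite lexx ler01|right; left].
- by split; [rewrite lexx ler01|right; right].
- by move=> t; rewrite nuE; exact: integral_set1.
- move=> a b s t [Ta Tb ab nT] as_ st tb.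
  have [/andP[a0 _] _] := Ta; have [/andP[_ b1] _] := Tb.
  rewrite nuI; last first.
    move=> u; rewrite /I /= !in_itv/= => /andP[su ut].
    by rewrite (le_trans a0 (le_trans as_ (ltW su))) (le_trans ut (le_trans tb b1)).
  have [|v v1 gv] := gF a b a0 ab b1.
    move=> u; rewrite in_itv/= => uab Fu; apply: (nT u uab).
    have /andP[au ub] := uab.
    have u01 : (0 <= u <= 1)%R by rewrite (le_trans a0 (ltW au)) (le_trans (ltW ub) b1).
    by split => //; left; rewrite -gG.
  apply: (straight_increment gG psi_meas psi_int psi_inc psi_der v1 a0 b1) => //.
- move=> s t C c Ts Tt st c0 DC; rewrite nuI.
    exact: (geodesic_shortcut m0 m1 p1 beta1 DE v01 GK gG psi_meas psi_int psi_der geo).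
  move=> u [/= + _]; have [/andP[s0 _] _] := Ts; have [/andP[_ t1] _] := Tt.
  rewrite /I /= !in_itv/= => /andP[su ut].
  by rewrite (le_trans s0 (ltW su)) (le_trans ut t1).
- move=> z; rewrite nuI; last by move=> t [].
  exact: (integral_speed_fiber GK gG psi_der).
- rewrite [X in X < _]nuI//.
  have := integrable_fin_num mI (integrable_speed psi_meas psi_int).
  by rewrite ge0_fin_numE// integral_ge0// => t _; rewrite lee_fin enorm_ge0.
- by move=> t t01; rewrite -lee_fin -DE -gG// gM.
Qed.

Theorem theorem4 (R : realType) (m beta : R)
    (m_gt0 : (0 < m)%R) (m_le1 : (m <= 1)%R) (beta_ge1 : (1 <= beta)%R) :
  exists lambda : R, (0 < lambda)%R /\
    forall (d : nat) (p : R), (1 <= p)%R ->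
    forall mu : probability (borelRd R d) R,
    (m = 1%R -> forall z : 'rV[R]_d, dtm m p mu z \is a fin_num) ->
    forall F : set 'rV[R]_d, closed F ->
    forall (x y : 'rV[R]_d) (g : R -> 'rV[R]_d),
    geodesic m p beta mu F x y g ->
    path_length g <= lambda%:E * dtm_max m p mu g.
Proof.
pose lambda := (2 * scale_cst m beta * (48 / m))%R.
have lambda0 : (0 < lambda)%R.
  have q (n : nat) : (0 < n.+1%:R / m)%R by rewrite divr_gt0.
  by rewrite mulr_gt0 ?q// mulr_gt0// mulr_gt0 ?powR_gt0 ?q.
exists lambda; split => // d p p1 mu m1fin F cF x y g geo.
have dfin z : dtm m p mu z \is a fin_num.
  move: m_le1; rewrite le_eqVlt => /predU1P[m1|m1]; first exact: m1fin.
  exact: dtm_fin.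
have le_max t : (0 <= t <= 1)%R -> dtm m p mu (g t) <= dtm_max m p mu g.
  by move=> t01; apply: ereal_sup_ubound; exists t => //=; rewrite in_itv.
have max0 : 0 <= dtm_max m p mu g.
  by apply: le_trans (le_max 0%R _); rewrite ?dtm_ge0// lexx ler01.
case: d => [|d] in mu m1fin F cF x y g geo dfin le_max max0 *.
  rewrite /path_length (eq_integral (cst 0)); last first.
    by move=> t _; rewrite /enorm big_ord0 sqrtr0.
  by rewrite integral0 mule_ge0// lee_fin ltW.
have [maxfin|] := boolP (dtm_max m p mu g \is a fin_num); last first.
  rewrite ge0_fin_numE// -leNgt leye_eq => /eqP ->.
  by rewrite gt0_muley ?leey// lte_fin.
pose M0 := fine (dtm_max m p mu g).
have M0E : dtm_max m p mu g = M0%:E by rewrite fineK.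
have M00 : (0 <= M0)%R by rewrite -lee_fin -M0E.
rewrite M0E -EFinM; apply/lee_addgt0Pr => e e0.
have el : (0 < e / lambda)%R by rewrite divr_gt0.
rewrite -EFinD [X in (_ <= X%:E)](_ : _ = lambda * (M0 + e / lambda))%R; last first.
  by rewrite mulrDr mulrCA divff ?gt_eqF// mulr1.
apply: (geodesic_length_le m_gt0 m_le1 p1 beta_ge1 dfin cF (unit_vector_exists R d) geo).
  by rewrite ltr_wpDl.
move=> t t01; apply: le_trans (le_max t t01) _.
by rewrite M0E lee_fin lerDl ltW.
Qed.
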